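(* Let $0<\varepsilon<1/2$, $q\in(0,1]$ and let $\mathcal G=(G_n)_{n\in\mathbb N}$ be an expander sequence. Let $(\tilde G_n)_{n\in\mathbb N}$ be such that each $\tilde G_n$ is obtained by deleting edges of $G_n$ such that each vertex keeps at least a $(1/2+\varepsilon)$ fraction of its edges. For $\mathcal P\in\{push,pp\}$ let $\tilde T_{\mathcal P}$ denote the number of rounds needed to inform at least $n-n/\log n$ vertices. Then whp (a) $\tilde T_{push}(\tilde G_n)=\log_{1+q}(n)+o(\log n)$; (b) $\tilde T_{pp}(\tilde G_n)\le\log_{1+2q}(n)+o(\log n)$, when additionally assuming that $\delta(G_n)\ge\alpha n$ for some $0<\alpha\le1$.
   Context: Rumour spreading protocols on a connected graph with $n$ vertices, one vertex initially informed, synchronous rounds; each message transmission succeeds independently with probability $q$. push: in each round every informed vertex chooses a neighbour independently and uniformly at random and (if the transmission succeeds) informs it. push\&pull (pp): in each round every vertex chooses a neighbour independently and uniformly at random, and if one of the two is informed (and the transmission succeeds) both become informed. An expander sequence is a sequence $(G_n)$ of connected graphs, $G_n$ on $n$ vertices with minimum degree $\delta_n=\delta(G_n)$, maximum degree $\Delta_n$, and $\lambda_n=\max\{|\mu_2|,|\mu_n|\}$ (from adjacency eigenvalues $\mu_1\ge\dots\ge\mu_n$), with $\Delta_n/\delta_n=1+o(1)$ and $\lambda_n=o(\Delta_n)$. ''Keeps at least a $(1/2+\varepsilon)$ fraction of its edges'' means $d_{\tilde G_n}(v)\ge(1/2+\varepsilon)d_{G_n}(v)$. whp means with probability $1-o(1)$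 as $n\to\infty$; natural log. $a=b+o(f)$ means $|a-b|\le g$ for some positive $g=o(f)$; $a\le b+o(f)$ means $a\le b+g$ for some positive $g=o(f)$. *)

(* Defs.v *)
From HB Require Import structures.
From mathcomp Require Import all_boot all_order all_algebra.
From mathcomp Require Import all_classical all_reals all_analysis.
Set Implicit Arguments. Unset Strict Implicit. Unset Printing Implicit Defensive.
Import Order.TTheory GRing.Theory Num.Theory.
Import numFieldNormedType.Exports.
Local Open Scope classical_set_scope.
Local Open Scope ring_scope.

Definition simple_graph (n : nat) (G : rel 'I_n) : Prop :=
  symmetric G /\ irreflexive G.

Definition connected_graph (n : nat) (G : rel 'I_n) : Prop :=
  forall u v : 'I_n, connect G u v.

Definition deg (n : nat) (G : rel 'I_n) (v : 'I_n) : nat :=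
  #|[set u | G v u]|.

Definition maxdeg (n : nat) (G : rel 'I_n) : nat := (\max_(v : 'I_n) deg G v)%N.
Definition mindeg (n : nat) (G : rel 'I_n) : nat := \big[minn/n]_(v : 'I_n) deg G v.

Definition adjmx (R : realType) (n : nat) (G : rel 'I_n) : 'M[R]_n :=
  \matrix_(i, j) (G i j)%:R.

Definition adj_spectrum (R : realType) (n : nat) (G : rel 'I_n) (mu : seq R) : Prop :=
  [/\ size mu = n, sorted >=%R mu &
      char_poly (adjmx R G) = \prod_(x <- mu) ('X - x%:P)].

Definition lambda_of (R : realType) (n : nat) (mu : seq R) : R :=
  Num.max `|mu`_1| `|mu`_n.-1|.

Definition expander_seq (R : realType) (G : forall n : nat, rel 'I_n) : Prop :=
  [/\ (forall n, simple_graph (G n)),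
      (forall n, connected_graph (G n)),
      (fun n : nat => (maxdeg (G n))%:R / (mindeg (G n))%:R : R) @ \oo --> (1 : R) &
      exists mu : nat -> seq R,
        (forall n, adj_spectrum (G n) (mu n)) /\
        (fun n : nat => lambda_of n (mu n) / (maxdeg (G n))%:R : R) @ \oo --> (0 : R)].

Definition keeps_fraction (R : realType) (eps : R) (n : nat) (G Gt : rel 'I_n) : Prop :=
  [/\ simple_graph Gt,
      subrel Gt G &
      forall v : 'I_n, (1 / 2 + eps) * (deg G v)%:R <= (deg Gt v)%:R].

(* In a round, every vertex v chooses c v, a uniform random neighbour      *)
(* (independently), and its transmission succeeds (s v = true)             *)
(* independently with probability q.  (A vertex of degree 0 — which can    *)
(* only happen for trivial n — "chooses" itself, a harmless convention.)   *)
(* In push only choices of informed vertices matter; letting all vertices  *)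
(* choose does not change the law of the process.                          *)

Inductive protocol := Push | PushPull.

Definition choice_weight (R : realType) (n : nat) (G : rel 'I_n) (v u : 'I_n) : R :=
  if deg G v == 0%N then (u == v)%:R else (G v u)%:R / (deg G v)%:R.

Definition round_weight (R : realType) (q : R) (n : nat) (G : rel 'I_n)
    (c : {ffun 'I_n -> 'I_n}) (s : {ffun 'I_n -> bool}) : R :=
  \prod_(v : 'I_n) (choice_weight R G v (c v) * (if s v then q else 1 - q)).

Definition next_informed (P : protocol) (n : nat) (A : {set 'I_n})
    (c : {ffun 'I_n -> 'I_n}) (s : {ffun 'I_n -> bool}) : {set 'I_n} :=
  match P with
  | Push => A :|: [set u | [exists v, [&& v \in A, s v & c v == u]]]
  | PushPull => A :|: [set u | [exists v, [&& v \in A, s v & c v == u]]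
                                || (s u && (c u \in A))]
  end.

Definition step (R : realType) (q : R) (P : protocol) (n : nat) (G : rel 'I_n)
    (D : {ffun {set 'I_n} -> R}) : {ffun {set 'I_n} -> R} :=
  [ffun B => \sum_(A : {set 'I_n}) D A *
      (\sum_(c : {ffun 'I_n -> 'I_n}) \sum_(s : {ffun 'I_n -> bool})
          round_weight q G c s * (next_informed P A c s == B)%:R)].

Definition informed_law (R : realType) (q : R) (P : protocol) (n : nat) (G : rel 'I_n)
    (S0 : {set 'I_n}) (t : nat) : {ffun {set 'I_n} -> R} :=
  iter t (step q P G) [ffun B => (B == S0)%:R].

Definition threshold (R : realType) (n : nat) : R := n%:R - n%:R / ln (n%:R : R).

(* Probability that T <= t, where T is the number of rounds needed to inform
   at least n - n/log n vertices.  Since informed sets only grow, the event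
   {T <= t} is exactly the event {informed set after t rounds has size
   >= threshold}. *)
Definition prob_T_le_nat (R : realType) (q : R) (P : protocol) (n : nat) (G : rel 'I_n)
    (S0 : {set 'I_n}) (t : nat) : R :=
  \sum_(B : {set 'I_n} | threshold R n <= (#|B|)%:R) informed_law q P G S0 t B.

Definition prob_T_le_int (R : realType) (q : R) (P : protocol) (n : nat) (G : rel 'I_n)
    (S0 : {set 'I_n}) (k : int) : R :=
  if k < 0 then 0 else prob_T_le_nat q P G S0 `|k|%N.

(* P(T <= x) for real x  (T integer-valued: T <= x iff T <= floor x) *)
Definition prob_T_le (R : realType) (q : R) (P : protocol) (n : nat) (G : rel 'I_n)
    (S0 : {set 'I_n}) (x : R) : R :=
  prob_T_le_int q P G S0 (Num.floor x).

(* P(T < y) for real y  (T < y iff T <= ceil y - 1) *)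
Definition prob_T_lt (R : realType) (q : R) (P : protocol) (n : nat) (G : rel 'I_n)
    (S0 : {set 'I_n}) (y : R) : R :=
  prob_T_le_int q P G S0 (Num.ceil y - 1).

(* P(a <= T <= b) for a <= b: {T < a} is contained in {T <= b}. *)
Definition prob_T_between (R : realType) (q : R) (P : protocol) (n : nat) (G : rel 'I_n)
    (S0 : {set 'I_n}) (a b : R) : R :=
  prob_T_le q P G S0 b - prob_T_lt q P G S0 a.

Definition start_set (n : nat) (s : nat) : {set 'I_n} := [set v : 'I_n | val v == s].

Definition logb (R : realType) (b x : R) : R := ln x / ln b.

(* Main.v *)
(* The growth is controlled through the reciprocal of the informed set, which
   is a supermartingale up to a factor rho < 1, so that no concentration bound
   per round is needed.  By the spectral theorem the adjacency operator of an
   expander contracts mean-zero vectors; hence a small informed set I spans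
   o(D |I|) edges and its members have o(|I|) common targets, and, as more than
   half of the edges at every vertex survive, every set of at most half of the
   vertices keeps a linear edge boundary.

   The boundary alone yields E[1/|I'|] <= (1 - c)/|I| up to |I| = n/2, and then
   geometric decay of the uninformed set: with K large and g small constants,
   o(log n) rounds suffice for the phases
   1 -> K, g n -> n/2 and n/2 -> n - n/log n.  In between (K -> g n) second
   moments give E[1/h(I')] <= (1/(1+rq) + o(1))/h(I), r = 1 for push and r = 2
   for push&pull, for a vertex weight h bounded above and below: h = 1 for push;
   for push&pull h(v) = sqrt d(v), since by AM-GM
   sum_(u ~ v) h(u) (1/d(u) + 1/d(v)) >= 2 h(v).  The lower bound for push is the
   first moment E|I_t| <= (1+q)^t. *)
Require Import Defs.
From HB Require Import structures.
From mathcomp Require Import all_boot all_order all_algebra.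
From mathcomp Require Import all_classical all_reals all_analysis.
From mathcomp Require Import perm complex ring lra.
Set Implicit Arguments. Unset Strict Implicit. Unset Printing Implicit Defensive.
Import Order.TTheory GRing.Theory Num.Theory.
Import numFieldNormedType.Exports.
Local Open Scope classical_set_scope.
Local Open Scope ring_scope.

(** The base 1 + rq must be exact, but E[1/X] >= 1/E[X], so a first moment bound on the growth does
    not bound the reciprocal from above; a variance has to be paid for. Its relative cost is
    O(1/|I|), which is why the sharp phase starts only at a large constant K, and collisions cost
    O(|I|/n + k), which is why it stops at g n. Outside that window any fixed contraction factor is
    good enough. The spectral input concerns G alone. It is used as upper bounds on edge counts,
    which deletion preserves, so nothing about the spectrum of the thinned graph is required; the
    lower bound on its boundary comes from subtracting inner edges from degrees. The thinned graph
    is far from regular: degrees may differ by a factor close to 2. A push along uv has rate 1/d(v)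
    and a pull 1/d(u), so the plain count need not grow by 1 + 2q under push&pull; the weight sqrt d
    balances the two directions. The order of choice is eta (the slack in the number of rounds),
    then k, g and K, then n. A diagonal argument at the end trades the fixed eta for o(log n). *)

(** * Spectral theorem and contraction of mean-zero vectors *)

Lemma simmx_char_poly (F : fieldType) (n : nat) (P A D : 'M[F]_n) :
  P \in unitmx -> P *m A = D *m P -> char_poly A = char_poly D.
Proof.
move=> Pu PAD.
have -> : A = invmx P *m D *m P by rewrite -mulmxA -PAD mulKmx.
rewrite /char_poly /char_poly_mx !map_mxM.
have e : map_mx polyC (invmx P) *m map_mx polyC P = 1%:M.
  by rewrite -map_mxM mulVmx // map_mx1.
have -> : 'X%:M - map_mx polyC (invmx P) *m map_mx polyC D *m map_mx polyC P
  = map_mx polyC (invmx P) *m ('X%:M - map_mx polyC D) *m map_mx polyC P.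
  rewrite mulmxBr mulmxBl; congr (_ - _).
  by rewrite scalar_mxC -mulmxA e mulmx1.
by rewrite !det_mulmx mulrAC -det_mulmx e det1 mul1r.
Qed.

(** A real symmetric matrix is normal over the complex numbers. Its spectral diagonal and [mu] split
    the same characteristic polynomial, so unique factorisation makes them equal up to the
    permutation [s]. *)
Lemma symmetric_diagonalization (R : realType) (n : nat) (A : 'M[R]_n) (mu : seq R) :
  A^T = A -> size mu = n -> char_poly A = \prod_(x <- mu) ('X - x%:P) ->
  exists (P : 'M[complex R]_n) (s : 'S_n),
    P \is unitarymx /\
    P *m map_mx (real_complex R) A =
      diag_mx (\row_i (real_complex R mu`_(s i))) *m P.
Proof.
move=> symA szmu chA.
set AC := map_mx (real_complex R) A.
have nA : AC \is normalmx.
  apply/normalmxP.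
  have -> : map_mx Num.conj_op AC^T = AC.
    rewrite /AC map_trmx symA -map_mx_comp; apply/matrixP => i j; rewrite !mxE /=.
    by rewrite conj_Creal // complex_real.
  by [].
have := nA; move/orthomx_spectralP.
set P := spectralmx AC; set sp := spectral_diag AC => AE.
have Pu : P \is unitarymx by exact: spectral_unitarymx.
have PU : P \in unitmx by exact: unitarymx_unit.
have PA : P *m AC = diag_mx sp *m P by rewrite {1}AE !mulmxA mulmxV // mul1mx.
have ch2 : \prod_(x <- map (real_complex R) mu) ('X - x%:P) =
           \prod_(x <- [tuple sp ord0 i | i < n]) ('X - x%:P).
  rewrite big_map.
  have -> : \prod_(j <- mu) ('X - ((real_complex R) j)%:P) =
     map_poly (real_complex R) (char_poly A).
    rewrite chA rmorph_prod; apply: eq_bigr => x _.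
    by rewrite rmorphB /= map_polyX map_polyC.
  rewrite map_char_poly -/AC (simmx_char_poly PU PA) char_poly_trig; last first.
    by apply/is_trig_mxP => i j ij; rewrite !mxE (negbTE (_ : i != j)) // -val_eqE /= ltn_eqF.
  rewrite big_tuple; apply: eq_bigr => i _.
  by rewrite !mxE eqxx mulr1n tnth_mktuple.
have {}ch2 := prod_XsubC_eq ch2.
have sz : size (map (real_complex R) mu) == n by rewrite size_map szmu.
have /tuple_permP [s Hs] : perm_eq [tuple sp ord0 i | i < n] (Tuple sz).
  by rewrite perm_sym.
exists P, s; split => //.
rewrite PA; congr (diag_mx _ *m P); apply/rowP => i; rewrite mxE.
have /(congr1 (fun t : seq (complex R) => nth 0 t i)) := Hs.
rewrite -!tnth_nth !tnth_mktuple => ->.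
by rewrite (tnth_nth 0) /= (nth_map 0) // szmu.
Qed.

(** Lagrange's identity: the double sum of the squares (a_i b_j - a_j b_i)^2 is twice the gap. *)
Lemma sum_cauchy_schwarz (R : realType) (I : finType) (P : pred I) (a b : I -> R) :
  (\sum_(i | P i) a i * b i) ^+ 2 <=
    (\sum_(i | P i) a i ^+ 2) * (\sum_(i | P i) b i ^+ 2).
Proof.
have h : 0 <= \sum_(i | P i) \sum_(j | P j) (a i * b j - a j * b i) ^+ 2.
  by apply: sumr_ge0 => i _; apply: sumr_ge0 => j _; exact: sqr_ge0.
have e : \sum_(i | P i) \sum_(j | P j) (a i * b j - a j * b i) ^+ 2 =
    2 * ((\sum_(i | P i) a i ^+ 2) * (\sum_(i | P i) b i ^+ 2)
         - (\sum_(i | P i) a i * b i) ^+ 2).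
  transitivity (\sum_(i | P i) \sum_(j | P j)
     ((a i ^+ 2 * b j ^+ 2 + b i ^+ 2 * a j ^+ 2) - 2 * ((a i * b i) * (a j * b j)))).
    by apply: eq_bigr => i _; apply: eq_bigr => j _; ring.
  under eq_bigr do rewrite sumrB big_split /= -mulr_sumr -!big_distrr /=.
  rewrite sumrB big_split /= -mulr_sumr -!big_distrl /=.
  ring.
nra.
Qed.

(** [y x] lists the coordinates of [x] in a complex eigenbasis. The shift [c] is later taken to be
    D, to test how far the all-one vector is from an eigenvector, and 0. *)
Lemma spectral_coordinates (R : realType) (n : nat) (A : 'M[R]_n) (mu : seq R) :
  A^T = A -> size mu = n -> char_poly A = \prod_(x <- mu) ('X - x%:P) ->
  exists (s : 'S_n) (y : 'cV[R]_n -> 'I_n -> complex R),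
    [/\ (forall x, \sum_i Normc.normc (y x i) ^+ 2 = \sum_i x i 0 ^+ 2),
        (forall x z, \sum_i y x i * conjc (y z i) =
                     real_complex R (\sum_i x i 0 * z i 0)) &
        (forall c x i, y (A *m x - c *: x) i =
                       real_complex R (mu`_(s i) - c) * y x i)].
Proof.
move=> symA szmu chA.
have [P [s [Pu PA]]] := symmetric_diagonalization symA szmu chA.
pose y (x : 'cV[R]_n) i := (P *m map_mx (real_complex R) x) i 0.
have dot x z : \sum_i y x i * conjc (y z i) = real_complex R (\sum_i x i 0 * z i 0).
  transitivity (((map_mx (real_complex R) z)^T *m
                  (map_mx Num.conj_op P)^T *m (P *m map_mx (real_complex R) x)) 0 0).
    rewrite [RHS]mxE; apply: eq_bigr => i _; rewrite mulrC; congr (_ * _).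
    rewrite /y -trmx_mul !mxE rmorph_sum; apply: eq_bigr => j _.
    by rewrite !mxE rmorphM /= oppr0.
  have PP : (map_mx Num.conj_op P)^T *m P = 1%:M.
    apply: etrans (mulmx1C (unitarymxP Pu)); congr (_ *m _).
    by apply/matrixP => i j; rewrite !mxE.
  rewrite -mulmxA (mulmxA _ P) PP mul1mx mxE rmorph_sum.
  by apply: eq_bigr => i _; rewrite !mxE -rmorphM mulrC.
exists s, y; split=> //.
- move=> x; apply: (@complexI R).
  have -> : \sum_i x i 0 ^+ 2 = \sum_i x i 0 * x i 0.
    by apply: eq_bigr => i _; rewrite expr2.
  rewrite -dot rmorph_sum; apply: eq_bigr => i _.
  by rewrite -sqr_normc rmorphXn /=.
- move=> c x i; rewrite /y map_mxB map_mxM mulmxBr mulmxA PA map_mxZ -scalemxAr.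
  by rewrite -mulmxA mul_diag_mx !mxE rmorphB mulrBl.
Qed.

(** G is only nearly regular, so the all-one vector [o] is not an eigenvector. It is close to the
    eigenline [k] of the top eigenvalue, and a vector orthogonal to [o] therefore has a small
    coordinate there; on the other coordinates A acts by at most [lam]. *)
Lemma mean_zero_contraction (R : realType) (n : nat) (A : 'M[R]_n.+1) (mu : seq R)
    (D lam th : R) :
  A^T = A -> size mu = n.+1 -> char_poly A = \prod_(x <- mu) ('X - x%:P) ->
  (forall i, (0 < i < n.+1)%N -> `|mu`_i| <= lam) ->
  0 <= lam < D -> th <= 1 / 2 ->
  \sum_i (\sum_j A i j - D) ^+ 2 <= th * n.+1%:R * (D - lam) ^+ 2 ->
  \sum_i (\sum_j A i j) ^+ 2 <= n.+1%:R * D ^+ 2 ->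
  forall x : 'I_n.+1 -> R, \sum_i x i = 0 ->
  \sum_i (\sum_j A i j * x j) ^+ 2 <=
    (4 * th * D ^+ 2 + lam ^+ 2) * \sum_i x i ^+ 2.
Proof.
move=> symA szmu chA mule /andP[lam0 lamD] th2 dev tot x x0.
have [s [y [yn yd yA]]] := spectral_coordinates symA szmu chA.
clear symA szmu chA.
pose N z i : R := Normc.normc (y z i) ^+ 2.
have N0 z i : 0 <= N z i by exact: sqr_ge0.
have NA c z i : N (A *m z - c *: z) i = (mu`_(s i) - c) ^+ 2 * N z i.
  rewrite /N yA Normc.normcM exprMn; congr (_ * _).
  by rewrite /= expr0n /= addr0 sqr_sqrtr ?sqr_ge0.
pose k := (s^-1)%g ord0.
have muk i : i != k -> `|mu`_(s i)| <= lam.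
  move=> ik; apply: mule; rewrite ltn_ord andbT lt0n.
  apply: contra ik => /eqP si0; apply/eqP.
  by rewrite /k -(permK s i); congr ((s^-1)%g _); exact: val_inj.
pose o : 'cV[R]_n.+1 := const_mx 1; pose xv : 'cV[R]_n.+1 := \col_i x i.
have yn' z : N z k + \sum_(i | i != k) N z i = \sum_i z i 0 ^+ 2.
  by rewrite -yn [RHS](bigD1 k).
have oE : \sum_i o i 0 ^+ 2 = n.+1%:R.
  rewrite (eq_bigr (fun=> 1)) ?sumr_const ?card_ord // => i _.
  by rewrite mxE expr1n.
have xE : \sum_i xv i 0 ^+ 2 = \sum_i x i ^+ 2.
  by apply: eq_bigr => i _; rewrite mxE.
have AoE i : (A *m o) i 0 = \sum_j A i j.
  by rewrite mxE; apply: eq_bigr => j _; rewrite mxE mulr1.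
have AxE i : (A *m xv) i 0 = \sum_j A i j * x j.
  by rewrite mxE; apply: eq_bigr => j _; rewrite mxE.
set W := \sum_(i | i != k) N o i.
have W0 : 0 <= W by apply: sumr_ge0.
(* Off [k] each eigenvalue is at distance at least D - lam from D, so the small vector (A - D) o
   controls the part of [o] off [k]. *)
have hW : (D - lam) ^+ 2 * W <= th * n.+1%:R * (D - lam) ^+ 2.
  apply: le_trans dev.
  have -> : \sum_i (\sum_j A i j - D) ^+ 2 = \sum_i (A *m o - D *: o) i 0 ^+ 2.
    by apply: eq_bigr => i _; rewrite mxE AoE !mxE mulr1.
  rewrite -(yn' (A *m o - D *: o)) mulr_sumr.
  apply: (@le_trans _ _ (\sum_(i | i != k) N (A *m o - D *: o) i)); last first.
    by rewrite lerDr.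
  apply: ler_sum => i ik; rewrite NA ler_wpM2r //.
  have := muk i ik; rewrite ler_norml => /andP[h1 h2].
  by rewrite -(sqrrN (mu`_(s i) - D)) lerXn2r ?nnegrE; lra.
have {}hW : W <= th * n.+1%:R.
  have p : 0 < (D - lam) ^+ 2 by rewrite exprn_gt0 // subr_gt0.
  by rewrite -(ler_pM2l p) (le_trans hW) // mulrC.
have Nok : N o k = n.+1%:R - W by have := yn' o; rewrite oE -/W; lra.
have n0 : 0 < n.+1%:R :> R by rewrite ltr0n.
have Nok2 : n.+1%:R / 2 <= N o k by rewrite Nok; nra.
(* The top eigenvalue is bounded through [o], at least half of whose squared norm lies on [k]. *)
have hmu : mu`_(s k) ^+ 2 <= 2 * D ^+ 2.
  have : mu`_(s k) ^+ 2 * N o k <= n.+1%:R * D ^+ 2.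
    apply: le_trans tot.
    have -> : \sum_i (\sum_j A i j) ^+ 2 = \sum_i (A *m o - 0 *: o) i 0 ^+ 2.
      by apply: eq_bigr => i _; rewrite scale0r subr0 AoE.
    rewrite -(yn' (A *m o - 0 *: o)) NA subr0 lerDl.
    by apply: sumr_ge0.
  by have := sqr_ge0 (mu`_(s k)); nra.
set X := \sum_i x i ^+ 2; set X' := \sum_(i | i != k) N xv i.
have X'0 : 0 <= X' by apply: sumr_ge0.
have XE : N xv k + X' = X by rewrite yn' xE.
(* Orthogonality of [x] and [o] expresses their product on [k] by the remaining coordinates, to
   which Cauchy-Schwarz applies. *)
have cross : N xv k * N o k <= X' * W.
  have d0 : \sum_i y xv i * conjc (y o i) = 0.
    rewrite yd; have -> : \sum_i xv i 0 * o i 0 = 0; last by [].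
    by rewrite -[RHS]x0; apply: eq_bigr => i _; rewrite !mxE mulr1.
  have e : `|y xv k * conjc (y o k)| <=
      \sum_(i | i != k) `|y xv i * conjc (y o i)|.
    move/eqP: d0; rewrite (bigD1 k) //= addr_eq0 => /eqP ->; rewrite normrN.
    exact: ler_norm_sum.
  have {e} : real_complex R (Normc.normc (y xv k) * Normc.normc (y o k)) <=
     real_complex R
      (\sum_(i | i != k) Normc.normc (y xv i) * Normc.normc (y o i)).
    rewrite rmorph_sum rmorphM /=; apply: le_trans (le_trans e _).
      by rewrite normrM normcJ.
    by apply: ler_sum => i _; rewrite normrM normcJ -rmorphM.
  rewrite lecR => e.
  have := sum_cauchy_schwarz (fun i => i != k) (fun i => Normc.normc (y xv i))
     (fun i => Normc.normc (y o i)).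
  rewrite -/X' -/W; apply: le_trans.
  rewrite /N -exprMn lerXn2r ?nnegrE //.
    by apply: mulr_ge0; exact: (@normr_ge0 R (Rcomplex R)).
  by apply: sumr_ge0 => i _; apply: mulr_ge0; exact: (@normr_ge0 R (Rcomplex R)).
have X0 : 0 <= X by apply: sumr_ge0 => i _; exact: sqr_ge0.
have Nxk : N xv k <= 2 * th * X.
  have : N xv k * (n.+1%:R / 2) <= X * (th * n.+1%:R).
    apply: le_trans (_ : N xv k * N o k <= _); first by rewrite ler_wpM2l.
    apply: le_trans cross _; apply: ler_pM => //.
    by rewrite -XE lerDr.
  by nra.
have -> : \sum_i (\sum_j A i j * x j) ^+ 2 = \sum_i (A *m xv - 0 *: xv) i 0 ^+ 2.
  by apply: eq_bigr => i _; rewrite scale0r subr0 AxE.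
rewrite -yn' NA subr0.
have h2 : \sum_(i | i != k) N (A *m xv - 0 *: xv) i <= lam ^+ 2 * X'.
  rewrite mulr_sumr; apply: ler_sum => i ik; rewrite NA subr0 ler_wpM2r //.
  by rewrite -real_normK ?num_real // lerXn2r ?nnegrE ?muk.
have Nk0 := N0 xv k.
have h3 : mu`_(s k) ^+ 2 * N xv k <= 2 * D ^+ 2 * (2 * th * X).
  by apply: ler_pM => //; exact: sqr_ge0.
have h4 : lam ^+ 2 * X' <= lam ^+ 2 * X.
  by rewrite ler_wpM2l ?sqr_ge0 // -XE lerDr.
lra.
Qed.

(** * Edge distribution of expanders *)

Lemma sum_ord_const (R : realType) (n : nat) (c : R) : \sum_(i < n) c = c * n%:R.
Proof. by rewrite sumr_const card_ord mulr_natr. Qed.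

Lemma maxdeg_ge (n : nat) (G : rel 'I_n) (v : 'I_n) : (deg G v <= maxdeg G)%N.
Proof. exact: leq_bigmax. Qed.

Lemma mindeg_le (n : nat) (G : rel 'I_n) (v : 'I_n) : (mindeg G <= deg G v)%N.
Proof.
rewrite /mindeg; have := mem_index_enum v; elim: index_enum => // w r IH.
rewrite inE big_cons => /orP[/eqP <-|/IH h]; first exact: geq_minl.
exact: leq_trans (geq_minr _ _) h.
Qed.

Lemma sum_adj (R : realType) (n : nat) (G : rel 'I_n) (v : 'I_n) :
  \sum_u (G v u)%:R = (deg G v)%:R :> R.
Proof.
rewrite /deg -sum1_card natr_sum [RHS]big_mkcond /=.
apply: eq_bigr => u _.
have -> : (u \in [set w | G v w]) = G v u.
  by apply/idP/idP => [/set_mem|/mem_set].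
by case: (G v u).
Qed.

(** The one-sided expander mixing lemma: the third clause bounds edges inside I, the fourth the
    number of paths of length two with both ends in I. The terms in |I|^2/n are those of a random
    graph, and [k] is the relative error. *)
Definition pseudorandom (R : realType) (n : nat) (G : rel 'I_n) (D k : R) : Prop :=
  [/\ 0 < D,
      forall v, (1 - k) * D <= (deg G v)%:R <= D,
      forall I : {set 'I_n}, \sum_(v in I) \sum_(u in I) (G v u)%:R <=
        D * (#|I|%:R ^+ 2 / n%:R + k * #|I|%:R) &
      forall I : {set 'I_n}, \sum_u (\sum_(v in I) (G v u)%:R) ^+ 2 <=
        2 * D ^+ 2 * (#|I|%:R ^+ 2 / n%:R + k * #|I|%:R)].

(** The contraction is applied to [g], the indicator of I minus its mean. A maps the indicator to
    (m/n) deg + A g; Cauchy-Schwarz against I gives the edge count, and (a + b)^2 <= 2 a^2 + 2 b^2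
    gives the squares. *)
Lemma mean_zero_pseudorandom (R : realType) (n : nat) (G : rel 'I_n.+1) (D k : R) :
  symmetric G -> 0 < D -> 0 < k <= 1 ->
  (forall v, (1 - k) * D <= (deg G v)%:R <= D) ->
  (forall x : 'I_n.+1 -> R, \sum_i x i = 0 ->
    \sum_i (\sum_j (G i j)%:R * x j) ^+ 2 <= (k * D) ^+ 2 * \sum_i x i ^+ 2) ->
  pseudorandom G D k.
Proof.
move=> symG D0 /andP[k0 k1] dg H.
have N0 : 0 < n.+1%:R :> R by rewrite ltr0n.
suff key (I : {set 'I_n.+1}) :
    \sum_(v in I) \sum_(u in I) (G v u)%:R <=
        D * (#|I|%:R ^+ 2 / n.+1%:R + k * #|I|%:R) /\
    \sum_u (\sum_(v in I) (G v u)%:R) ^+ 2 <=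
        2 * D ^+ 2 * (#|I|%:R ^+ 2 / n.+1%:R + k * #|I|%:R).
  by split=> // I; case: (key I).
set m : R := #|I|%:R; have m0 : 0 <= m by rewrite ler0n.
have sI (F : 'I_n.+1 -> R) : \sum_(v in I) F v = \sum_v (v \in I)%:R * F v.
  by rewrite big_mkcond; apply: eq_bigr => v _; case: (v \in I); rewrite ?mul1r ?mul0r.
have mE : \sum_v (v \in I)%:R = m.
  by rewrite /m -sum1_card natr_sum [RHS]big_mkcond; apply: eq_bigr => v _; case: (v \in I).
pose g v : R := (v \in I)%:R - m / n.+1%:R.
have g0 : \sum_v g v = 0.
  by rewrite sumrB mE sum_ord_const divfK ?subrr // gt_eqF.
have g2 : \sum_v g v ^+ 2 <= m.
  have -> : \sum_v g v ^+ 2 =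
     \sum_v ((v \in I)%:R * (1 - 2 * (m / n.+1%:R)) + (m / n.+1%:R) ^+ 2).
    by apply: eq_bigr => v _; rewrite /g; case: (v \in I); rewrite /=; ring.
  rewrite big_split /= -mulr_suml mE sum_ord_const.
  have -> : (m / n.+1%:R) ^+ 2 * n.+1%:R = m * (m / n.+1%:R).
    by field; rewrite gt_eqF.
  have h : 0 <= m * (m / n.+1%:R) by rewrite mulr_ge0 ?divr_ge0 // ltW.
  move: h; set x := m / _ => h; nra.
have := H g g0; set Ag := fun i => \sum_j (G i j)%:R * g j => hAg.
have {}hAg : \sum_i Ag i ^+ 2 <= (k * D) ^+ 2 * m.
  by apply: le_trans hAg _; rewrite ler_wpM2l ?sqr_ge0.
have dI v : \sum_(u in I) (G v u)%:R = (m / n.+1%:R) * (deg G v)%:R + Ag v.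
  rewrite sI -sum_adj mulr_sumr -big_split /=; apply: eq_bigr => u _.
  by rewrite /g; ring.
split.
- under eq_bigr do rewrite dI.
  rewrite big_split /=.
  have h1 : \sum_(i in I) m / n.+1%:R * (deg G i)%:R <= D * (m ^+ 2 / n.+1%:R).
    apply: (@le_trans _ _ (\sum_(i in I) m / n.+1%:R * D)).
      apply: ler_sum => v _; rewrite ler_wpM2l ?divr_ge0 ?ler0n //.
      by case/andP: (dg v).
    rewrite sumr_const -(mulr_natr (m / _ * _)) -/m.
    by rewrite le_eqVlt; apply/orP; left; apply/eqP; ring.
  have h2 : (\sum_(i in I) Ag i) ^+ 2 <= (k * D * m) ^+ 2.
    rewrite sI; apply: le_trans (sum_cauchy_schwarz _ _ _) _.
    have -> : \sum_(i : 'I_n.+1) ((i \in I)%:R : R) ^+ 2 = m.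
      by rewrite -mE; apply: eq_bigr => v _; case: (v \in I); rewrite /= ?expr1n ?expr0n.
    rewrite [leRHS](_ : _ = m * ((k * D) ^+ 2 * m)); last by ring.
    by rewrite ler_wpM2l.
  have h3 : \sum_(i in I) Ag i <= k * D * m.
    apply: le_trans (ler_norm _) _.
    have kDm : 0 <= k * D * m by rewrite mulr_ge0 // mulr_ge0 // ltW.
    by rewrite -ler_sqr ?nnegrE // real_normK ?num_real.
  by rewrite mulrDr lerD // mulrA (mulrC D).
- have -> : \sum_u (\sum_(v in I) (G v u)%:R) ^+ 2 =
     \sum_u (m / n.+1%:R * (deg G u)%:R + Ag u) ^+ 2 :> R.
    by apply: eq_bigr => u _; rewrite -dI; congr (_ ^+ 2); apply: eq_bigr => v _; rewrite symG.
  apply: (@le_trans _ _ (\sum_u (2 * (m / n.+1%:R * D) ^+ 2 + 2 * Ag u ^+ 2))).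
    apply: ler_sum => u _.
    apply: (@le_trans _ _ (2 * (m / n.+1%:R * (deg G u)%:R) ^+ 2 + 2 * Ag u ^+ 2)).
      set a := m / _ * _; have := sqr_ge0 (a - Ag u); nra.
    have mn0 : 0 <= m / n.+1%:R by rewrite divr_ge0 ?ler0n.
    have /andP[_ dD] := dg u.
    rewrite lerD2r ler_pM2l // lerXn2r ?nnegrE ?mulr_ge0 ?ler0n // ?(ltW D0) //.
    by rewrite ler_wpM2l.
  rewrite big_split /= sum_ord_const -mulr_sumr.
  have -> : 2 * (m / n.+1%:R * D) ^+ 2 * n.+1%:R = 2 * D ^+ 2 * (m ^+ 2 / n.+1%:R).
    by field; rewrite gt_eqF.
  have hk : k ^+ 2 <= k by rewrite expr2 ger_pMl.
  have : D ^+ 2 * m * k ^+ 2 <= D ^+ 2 * m * k.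
    by rewrite ler_wpM2l // mulr_ge0 ?sqr_ge0.
  move: hAg; set S := \sum_i _; rewrite mulrDr => hAg h; rewrite lerD2l.
  nra.
Qed.

Lemma lambda_of_ge (R : realType) (n : nat) (mu : seq R) (i : nat) :
  size mu = n -> sorted >=%R mu -> (0 < i < n)%N -> `|mu`_i| <= lambda_of n mu.
Proof.
move=> sz st /andP[i0 iN].
have mono a b : (a <= b)%N -> (b < n)%N -> mu`_b <= mu`_a.
  move=> ab bn.
  have tr : transitive (>=%R : rel R) by move=> x y z /= h1 h2; exact: le_trans h2 h1.
  have rf : reflexive (>=%R : rel R) by move=> x /=.
  apply: (sorted_leq_nth tr rf 0 st) => //; rewrite inE sz //.
  exact: leq_ltn_trans ab bn.
rewrite /lambda_of le_max.
have n1 : (n.-1 < n)%N by rewrite prednK // (leq_ltn_trans _ iN).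
have h1 := mono 1%N i i0 iN.
have h2 : mu`_n.-1 <= mu`_i by apply: mono => //; rewrite -ltnS prednK // (leq_ltn_trans _ iN).
case: (lerP 0 mu`_i) => hi.
  by apply/orP; left; rewrite ger0_norm // (le_trans h1) // ler_norm.
apply/orP; right; rewrite ltr0_norm // -normrN.
by rewrite (le_trans _ (ler_norm _)) // lerN2.
Qed.

(** Since D - lam >= D/2, row sums within hD of D allow th = 4 h^2 in [mean_zero_contraction]. The
    contraction factor is then at most 16 h^2 + h^2 <= (5h)^2 in units of D^2, which is the origin
    of 5. *)
Lemma spectral_pseudorandom (R : realType) (n : nat) (G : rel 'I_n) (mu : seq R) (h k : R) :
  (0 < n)%N -> symmetric G -> adj_spectrum G mu -> 0 < h -> 5 * h <= k -> h <= 1 / 5 ->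
  `|1 - (maxdeg G)%:R / (mindeg G)%:R| < h ->
  `|0 - lambda_of n mu / (maxdeg G)%:R| < h ->
  pseudorandom G (maxdeg G)%:R k.
Proof.
case: n G => // n G _ symG [szm sm chm] h0 hk h5.
have dmax := @maxdeg_ge _ G; have dmin := @mindeg_le _ G.
set D : R := (maxdeg G)%:R; set d : R := (mindeg G)%:R; set lam := lambda_of _ _.
rewrite sub0r normrN => H1 H2.
have D0' : 0 <= D by rewrite ler0n.
have d0' : 0 <= d by rewrite ler0n.
have dv v : d <= (deg G v)%:R :> R by rewrite ler_nat.
have Dv v : (deg G v)%:R <= D by rewrite ler_nat.
have lam0 : 0 <= lam by rewrite le_max normr_ge0.
(* If d = 0, the quotient D/d is 0 by convention, at distance 1 from its limit. *)
have d0 : 0 < d.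
  rewrite lt_neqAle d0' andbT eq_sym; apply/eqP => dz.
  by move: H1; rewrite dz invr0 mulr0 subr0 normr1; lra.
have D0 : 0 < D := lt_le_trans d0 (le_trans (dv ord0) (Dv ord0)).
have {}H1 : D <= (1 + h) * d.
  by move: H1; rewrite ltr_norml => /andP[+ _]; rewrite -ler_pdivrMr //; lra.
have {}H2 : lam <= h * D.
  by rewrite -ler_pdivrMr //; apply: le_trans (ler_norm _) (ltW H2).
have dD : (1 - h) * D <= d by nra.
have hd v : (1 - h) * D <= (deg G v)%:R <= D.
  by rewrite Dv andbT (le_trans dD).
have rowE i : \sum_j (adjmx R G) i j = (deg G i)%:R.
  by rewrite -sum_adj; apply: eq_bigr => j _; rewrite mxE.
have H : pseudorandom G D (5 * h); last first.
  case: H => _ _ P2 P3.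
  have mono (I : {set 'I_n.+1}) : #|I|%:R ^+ 2 / n.+1%:R + 5 * h * #|I|%:R <=
     #|I|%:R ^+ 2 / n.+1%:R + k * #|I|%:R :> R.
    by rewrite lerD2l ler_wpM2r ?ler0n //; lra.
  split=> //.
  - by move=> v; apply/andP; split; [case/andP: (hd v) => + _; nra|].
  - by move=> I; apply: le_trans (P2 I) _; rewrite ler_wpM2l.
  - by move=> I; apply: le_trans (P3 I) _; rewrite ler_wpM2l ?mulr_ge0 ?sqr_ge0.
apply: mean_zero_pseudorandom => //.
- by apply/andP; split; lra.
- by move=> v; apply/andP; split; [case/andP: (hd v) => + _; nra|].
move=> x x0.
have symA : (adjmx R G)^T = adjmx R G by apply/matrixP => i j; rewrite !mxE symG.
have := @mean_zero_contraction R n (adjmx R G) mu D lam (4 * h ^+ 2) symA szm chm.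
move=> /(_ _ _ _ _ _ x x0) H.
have : \sum_i (\sum_j adjmx R G i j * x j) ^+ 2 <=
    (4 * (4 * h ^+ 2) * D ^+ 2 + lam ^+ 2) * \sum_i x i ^+ 2.
  have mule i (hi : (0 < i < n.+1)%N) : `|mu`_i| <= lam := lambda_of_ge szm sm hi.
  clear symA szm chm; apply: H.
  - exact: mule.
  - by rewrite lam0 /=; nra.
  - by nra.
  - have q1 : D ^+ 2 / 4 <= (D - lam) ^+ 2.
      by have e : D / 2 <= D - lam; nra.
    apply: (@le_trans _ _ (\sum_(i < n.+1) (h * D) ^+ 2)).
      apply: ler_sum => i _; rewrite rowE.
      have := Dv i; have := dv i => a b.
      by rewrite -(sqrrN ((deg G i)%:R - D)) lerXn2r ?nnegrE; nra.
    rewrite sum_ord_const.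
    have -> : 4 * h ^+ 2 * n.+1%:R * (D - lam) ^+ 2 =
      (h ^+ 2 * (4 * (D - lam) ^+ 2)) * n.+1%:R by ring.
    rewrite ler_wpM2r ?ler0n // exprMn ler_wpM2l ?sqr_ge0 //; lra.
  - apply: (@le_trans _ _ (\sum_(i < n.+1) D ^+ 2)).
      by apply: ler_sum => i _; rewrite rowE lerXn2r ?nnegrE ?ler0n.
    by rewrite sum_ord_const mulrC.
have -> : \sum_i (\sum_j adjmx R G i j * x j) ^+ 2 = \sum_i (\sum_j (G i j)%:R * x j) ^+ 2.
  by apply: eq_bigr => i _; congr (_ ^+ 2); apply: eq_bigr => j _; rewrite mxE.
move/le_trans; apply; rewrite ler_wpM2r //.
  by apply: sumr_ge0 => i _; exact: sqr_ge0.
have l2 : lam ^+ 2 <= (h * D) ^+ 2 by rewrite lerXn2r ?nnegrE // mulr_ge0 // ltW.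
have : 0 <= (h * D) ^+ 2 by exact: sqr_ge0.
by nra.
Qed.

Lemma expander_pseudorandom (R : realType) (G : forall n : nat, rel 'I_n) (k : R) :
  expander_seq R G -> 0 < k ->
  \forall n \near \oo, pseudorandom (G n) ((maxdeg (G n))%:R : R) k.
Proof.
case=> sG cG dD [mu [spec lamD]] k0.
pose h := Num.min (k / 5) (1 / 5 : R).
have h0 : 0 < h by rewrite lt_min; apply/andP; split; lra.
have hk : h <= k / 5 by rewrite ge_min lexx.
have h5 : h <= 1 / 5 by rewrite ge_min lexx orbT.
have /cvgrPdist_lt /(_ h h0) H1 := dD.
have /cvgrPdist_lt /(_ h h0) H2 := lamD.
near=> n; apply: (@spectral_pseudorandom _ _ _ (mu n) h) => //.
- by near: n; exists 1%N.
- by case: (sG n).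
- by lra.
- by near: n; exact: H1.
- by near: n; exact: H2.
Unshelve. all: by end_near.
Qed.

(** * Expectation over independent coordinates *)

Section ProductMeasure.
Variables (R : realType) (I T : finType) (w : I -> T -> R).
Hypothesis w_ge0 : forall i t, 0 <= w i t.
Hypothesis w_sum1 : forall i, \sum_t w i t = 1.
Implicit Types (F H : {ffun I -> T} -> R).

Definition pexp F : R := \sum_(f : {ffun I -> T}) (\prod_i w i (f i)) * F f.
Definition marg (i : I) (g : T -> R) : R := \sum_t w i t * g t.

Lemma pexp_prod (g : I -> T -> R) :
  pexp (fun f => \prod_i g i (f i)) = \prod_i marg i (g i).
Proof.
rewrite /pexp /marg bigA_distr_bigA /=.
by apply: eq_bigr => f _; rewrite -big_split.
Qed.

Lemma eq_pexp F H : F =1 H -> pexp F = pexp H.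
Proof. by move=> e; apply: eq_bigr => f _; rewrite e. Qed.

Lemma marg_cst i (c : R) : marg i (fun=> c) = c.
Proof. by rewrite /marg -mulr_suml w_sum1 mul1r. Qed.

Lemma pexp_cst (c : R) : pexp (fun=> c) = c.
Proof.
rewrite /pexp -mulr_suml.
have e : pexp (fun f => \prod_(i : I) 1) = \sum_(f : {ffun I -> T}) \prod_i w i (f i).
  by apply: eq_bigr => f _; rewrite [X in _ * X]big1 ?mulr1.
rewrite -e (pexp_prod (fun _ _ => 1)) big1 ?mul1r // => i _.
by rewrite marg_cst.
Qed.

Lemma ler_pexp F H : (forall f, F f <= H f) -> pexp F <= pexp H.
Proof.
by move=> FH; apply: ler_sum => f _; rewrite ler_wpM2l // prodr_ge0.
Qed.

Lemma pexpD F H : pexp (fun f => F f + H f) = pexp F + pexp H.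
Proof. by rewrite /pexp -big_split; apply: eq_bigr => f _; rewrite mulrDr. Qed.

Lemma pexpZ (a : R) F : pexp (fun f => a * F f) = a * pexp F.
Proof. by rewrite /pexp mulr_sumr; apply: eq_bigr => f _; rewrite mulrCA. Qed.

Lemma pexp_sum (J : finType) (P : pred J) (F : J -> {ffun I -> T} -> R) :
  pexp (fun f => \sum_(j | P j) F j f) = \sum_(j | P j) pexp (F j).
Proof.
rewrite /pexp exchange_big /=; apply: eq_bigr => f _; exact: mulr_sumr.
Qed.

Lemma pexp_coord i (g : T -> R) : pexp (fun f => g (f i)) = marg i g.
Proof.
rewrite (eq_pexp (H := fun f => \prod_j (if j == i then g (f j) else 1))).
  rewrite (pexp_prod (fun j t => if j == i then g t else 1)) (bigD1 i) //= eqxx.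
  by rewrite big1 ?mulr1 // => j /negbTE ->; rewrite marg_cst.
by move=> f; rewrite -big_mkcond big_pred1_eq.
Qed.

Lemma pexp_coord2 i j (g h : T -> R) : i != j ->
  pexp (fun f => g (f i) * h (f j)) = marg i g * marg j h.
Proof.
move=> ij.
pose k l t := if l == i then g t else if l == j then h t else 1.
rewrite (eq_pexp (H := fun f => \prod_l k l (f l))).
  rewrite (pexp_prod k) (bigD1 i) //= (bigD1 j) 1?eq_sym //= /k eqxx.
  rewrite eq_sym (negbTE ij) eqxx big1 ?mulr1 //.
  by move=> l /andP[/negbTE -> /negbTE ->]; rewrite marg_cst.
move=> f; rewrite (bigD1 i) //= (bigD1 j) 1?eq_sym //= /k eqxx.
rewrite eq_sym (negbTE ij) eqxx big1 ?mulr1 //.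
by move=> l /andP[/negbTE -> /negbTE ->].
Qed.

Lemma ler_marg i (g h : T -> R) : (forall t, g t <= h t) -> marg i g <= marg i h.
Proof. by move=> gh; apply: ler_sum => t _; rewrite ler_wpM2l. Qed.

(** Independence factors the cross terms; the squares (E a_i)^2 missing on the diagonal are
    nonnegative and are added. *)
Lemma pexp_second_moment (a : I -> T -> R) :
  pexp (fun f => (\sum_i a i (f i)) ^+ 2) <=
    \sum_i marg i (fun t => a i t ^+ 2) + (\sum_i marg i (a i)) ^+ 2.
Proof.
rewrite (eq_pexp (H := fun f => \sum_i \sum_j a i (f i) * a j (f j))); last first.
  by move=> f; rewrite expr2 mulr_suml; apply: eq_bigr => i _; rewrite mulr_sumr.
rewrite pexp_sum [X in _ + X]expr2 mulr_suml -big_split /=.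
apply: ler_sum => i _; rewrite pexp_sum mulr_sumr (bigD1 i) //=.
rewrite [\sum_j marg i _ * _](bigD1 i) //= addrA; apply: lerD.
  rewrite (pexp_coord i (fun t => a i t * a i t)).
  by rewrite ler_wpDr // -expr2 sqr_ge0.
by apply: ler_sum => j ji; rewrite pexp_coord2 // eq_sym.
Qed.

Lemma pexp_variance (a : I -> T -> R) (b m : R) :
  m = b + \sum_i marg i (a i) ->
  pexp (fun f => (b + \sum_i a i (f i) - m) ^+ 2) <=
    \sum_i marg i (fun t => a i t ^+ 2).
Proof.
move=> ->; set M := \sum_i marg i (a i).
have e : pexp (fun f => (b + \sum_i a i (f i) - (b + M)) ^+ 2) =
  pexp (fun f => (\sum_i a i (f i)) ^+ 2) - M ^+ 2.
  rewrite (eq_pexp (H := fun f => (\sum_i a i (f i)) ^+ 2 +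
     (- (2 * M) * (\sum_i a i (f i)) + M ^+ 2))); last by move=> f; ring.
  rewrite pexpD pexpD pexpZ pexp_cst pexp_sum.
  by under eq_bigr do rewrite pexp_coord; rewrite -/M; ring.
by rewrite e lerBlDr pexp_second_moment.
Qed.

End ProductMeasure.

(** * The transition operator of the informed set and its drift *)

Section Kernel.
Variables (R : realType) (q : R) (n : nat) (G : rel 'I_n).
Hypothesis q01 : 0 <= q <= 1.
Implicit Types (P : protocol) (A B : {set 'I_n}) (f : {ffun 'I_n -> 'I_n * bool}).

Definition call_weight (v : 'I_n) (t : 'I_n * bool) : R :=
  choice_weight R G v t.1 * (if t.2 then q else 1 - q).

Lemma choice_weight_ge0 v u : 0 <= choice_weight R G v u.
Proof. by rewrite /choice_weight; case: ifP => _; rewrite ?divr_ge0 ?ler0n. Qed.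

Lemma choice_weight_sum1 v : \sum_u choice_weight R G v u = 1.
Proof.
rewrite /choice_weight; case: (eqVneq (deg G v) 0%N) => [_|d0].
  rewrite (bigD1 v) //= eqxx big1 ?addr0 // => u /negbTE -> //.
by rewrite -mulr_suml sum_adj divff // pnatr_eq0.
Qed.

Lemma call_weight_ge0 v t : 0 <= call_weight v t.
Proof.
case/andP: q01 => q0 q1.
by rewrite mulr_ge0 ?choice_weight_ge0 //; case: ifP => _; rewrite ?subr_ge0.
Qed.

Lemma sum_call_weight (v : 'I_n) (F : 'I_n -> bool -> R) :
  \sum_t call_weight v t * F t.1 t.2 =
  \sum_u choice_weight R G v u * (q * F u true + (1 - q) * F u false).
Proof.
rewrite -(pair_bigA _ (fun u b => call_weight v (u, b) * F u b)) /=.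
apply: eq_bigr => u _; rewrite big_bool /call_weight /=; ring.
Qed.

Lemma call_weight_sum1 v : \sum_t call_weight v t = 1.
Proof.
have := sum_call_weight v (fun _ _ => 1).
under eq_bigr do rewrite mulr1.
move=> ->; rewrite -[RHS](choice_weight_sum1 v); apply: eq_bigr => u _; ring.
Qed.

Definition inform P A f : {set 'I_n} :=
  next_informed P A [ffun v => (f v).1] [ffun v => (f v).2].

(** The transition operator on test functions. Probabilities become iterates applied to indicators,
    so conditioning on the past reduces to composing iterates. *)
Definition Kop P (phi : {set 'I_n} -> R) (A : {set 'I_n}) : R :=
  pexp call_weight (fun f => phi (inform P A f)).

Lemma round_pexp (F : {ffun 'I_n -> 'I_n} -> {ffun 'I_n -> bool} -> R) :
  \sum_c \sum_s round_weight q G c s * F c s =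
  pexp call_weight (fun f => F [ffun v => (f v).1] [ffun v => (f v).2]).
Proof.
rewrite /pexp pair_bigA /=.
pose split (f : {ffun 'I_n -> 'I_n * bool}) : {ffun 'I_n -> 'I_n} * {ffun 'I_n -> bool} :=
  ([ffun v => (f v).1], [ffun v => (f v).2]).
rewrite (reindex split) /=; last first.
  exists (fun p : {ffun 'I_n -> 'I_n} * {ffun 'I_n -> bool} => [ffun v => (p.1 v, p.2 v)]) => [f|[c s]] _ /=.
    by apply/ffunP => v; rewrite !ffunE -surjective_pairing.
  by congr pair; apply/ffunP => v; rewrite !ffunE.
apply: eq_bigr => f _; congr (_ * _); rewrite /round_weight.
by apply: eq_bigr => v _; rewrite !ffunE.
Qed.

(** [step] on laws is adjoint to [Kop] on functions. The induction peels off the last round and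
    moves it onto [phi], whence [iterSr]. *)
Lemma informed_law_Kop P (S0 : {set 'I_n}) t (phi : {set 'I_n} -> R) :
  \sum_B informed_law q P G S0 t B * phi B = iter t (Kop P) phi S0.
Proof.
elim: t phi => [|t IH] phi.
  rewrite /informed_law /= (bigD1 S0) //= ffunE eqxx mul1r big1 ?addr0 // => B BS.
  by rewrite ffunE (negbTE BS) mul0r.
rewrite iterSr -IH /informed_law iterS -/(informed_law q P G S0 t).
under eq_bigr do rewrite ffunE mulr_suml.
rewrite exchange_big /=; apply: eq_bigr => A _.
under eq_bigr do rewrite -mulrA.
rewrite -mulr_sumr; congr (_ * _).
transitivity (\sum_c \sum_s round_weight q G c s * phi (next_informed P A c s)).
  under eq_bigr do rewrite mulr_suml.
  rewrite exchange_big /=; apply: eq_bigr => c _.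
  under eq_bigr do rewrite mulr_suml.
  rewrite exchange_big /=; apply: eq_bigr => s _.
  rewrite (bigD1 (next_informed P A c s)) //= eqxx mulr1 big1 ?addr0 // => B.
  by rewrite eq_sym => /negbTE ->; rewrite mulr0 mul0r.
by rewrite (round_pexp (fun c s => phi (next_informed P A c s))).
Qed.

Lemma prob_T_le_natE P (S0 : {set 'I_n}) t :
  prob_T_le_nat q P G S0 t =
  iter t (Kop P) (fun B => (threshold R n <= #|B|%:R)%R%:R) S0.
Proof.
rewrite -informed_law_Kop /prob_T_le_nat big_mkcond /=.
by apply: eq_bigr => B _; case: ifP; rewrite ?mulr1 ?mulr0.
Qed.

Lemma subset_inform P A f : A \subset inform P A f.
Proof. by rewrite /inform /next_informed; case: P; exact: finset.subsetUl. Qed.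

Lemma inform_push_sub A f : inform Push A f \subset inform PushPull A f.
Proof.
apply/fintype.subsetP => u; rewrite /inform /next_informed !inE.
by case/orP => [->//|->]; rewrite orbT.
Qed.

Lemma Kop_le P (phi psi : {set 'I_n} -> R) A :
  (forall B, A \subset B -> phi B <= psi B) -> Kop P phi A <= Kop P psi A.
Proof.
move=> h; apply: ler_pexp => [|f]; first exact: call_weight_ge0.
by apply: h; exact: subset_inform.
Qed.

Lemma KopZ P (a : R) phi A : Kop P (fun B => a * phi B) A = a * Kop P phi A.
Proof. exact: pexpZ. Qed.

Lemma Kop_addc P (a : R) phi A : Kop P (fun B => phi B + a) A = Kop P phi A + a.
Proof.
by rewrite /Kop (pexpD _ (fun f => phi (inform P A f)) (fun=> a)) pexp_cst //
   => v; exact: call_weight_sum1.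
Qed.

Lemma iter_Kop_le P (phi psi : {set 'I_n} -> R) t A :
  (forall B, phi B <= psi B) -> iter t (Kop P) phi A <= iter t (Kop P) psi A.
Proof.
move=> h; elim: t A => [|t IH] A //=.
by apply: Kop_le => B _.
Qed.

Lemma iter_Kop_addc P (a : R) phi t A :
  iter t (Kop P) (fun B => phi B + a) A = iter t (Kop P) phi A + a.
Proof.
elim: t A => //= t IH A; rewrite -Kop_addc.
by apply: eq_pexp => f; rewrite IH.
Qed.

Lemma iter_KopN P phi t A :
  iter t (Kop P) (fun B => - phi B) A = - iter t (Kop P) phi A.
Proof.
elim: t A => //= t IH A.
have -> : - Kop P (iter t (Kop P) phi) A = Kop P (fun B => -1 * iter t (Kop P) phi B) A.
  by rewrite KopZ mulN1r.
by apply: eq_pexp => f; rewrite IH mulN1r.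
Qed.

Lemma iter_Kop_le1 P (phi : {set 'I_n} -> R) (c : R) t A :
  (forall B, phi B <= c) -> iter t (Kop P) phi A <= c.
Proof.
move=> h; elim: t A => [|t IH] A //=.
apply: le_trans (_ : Kop P (fun=> c) A <= _); first by apply: Kop_le.
by rewrite /Kop pexp_cst // => v; exact: call_weight_sum1.
Qed.

(** Markov's inequality for a supermartingale stopped at the goal: [phi] is at least 1 while the
    goal is missed and shrinks by [rho] in mean. Monotonicity makes the goal absorbing and keeps the
    process inside [dom], where the estimates hold. *)
Lemma drift P (dom goal : pred {set 'I_n}) (phi : {set 'I_n} -> R) (rho : R) :
  (forall A B, A \subset B -> dom A -> dom B) ->
  (forall A B, A \subset B -> goal A -> goal B) ->
  0 <= rho ->
  (forall A, 0 <= phi A) ->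
  (forall A, dom A -> ~~ goal A -> 1 <= phi A) ->
  (forall A, dom A -> ~~ goal A -> Kop P phi A <= rho * phi A) ->
  forall t A, dom A ->
  iter t (Kop P) (fun B => (~~ goal B)%:R) A <= rho ^+ t * phi A.
Proof.
move=> domM goalM rho0 phi0 phi1 Kphi.
have absorb t A : goal A -> iter t (Kop P) (fun B => (~~ goal B)%:R) A <= 0.
  elim: t A => [|t IH] A gA /=; first by rewrite gA.
  apply: le_trans (_ : Kop P (fun=> 0) A <= _).
    by apply: Kop_le => B AB; apply: IH; exact: goalM gA.
  by rewrite /Kop pexp_cst // => v; exact: call_weight_sum1.
elim=> [|t IH] A dA.
  rewrite expr0 mul1r /=; case: (boolP (goal A)) => gA.
    exact: phi0.
  exact: phi1.
case: (boolP (goal A)) => gA.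
  by apply: le_trans (absorb _ _ gA) _; rewrite mulr_ge0 ?exprn_ge0.
rewrite iterS; apply: le_trans (_ : Kop P (fun B => rho ^+ t * phi B) A <= _).
  by apply: Kop_le => B AB; apply: IH; exact: domM dA.
rewrite KopZ exprSr -mulrA ler_wpM2l ?exprn_ge0 //; exact: Kphi.
Qed.

(** Markov property and union bound: either the first goal is missed after s rounds, or the second
    is missed from some state in the first. *)
Lemma iter_Kop_chain P (goal goal' : pred {set 'I_n}) (a b : R) s t A :
  0 <= b ->
  iter s (Kop P) (fun B => (~~ goal B)%:R) A <= a ->
  (forall B, goal B -> iter t (Kop P) (fun C => (~~ goal' C)%:R) B <= b) ->
  iter (s + t) (Kop P) (fun C => (~~ goal' C)%:R) A <= a + b.
Proof.
move=> b0 ha hb; rewrite iterD.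
apply: le_trans (_ : iter s (Kop P) (fun B => (~~ goal B)%:R + b) A <= _).
  apply: iter_Kop_le => B; case: (boolP (goal B)) => gB /=.
    by rewrite add0r; exact: hb.
  apply: le_trans (_ : 1 <= _); last by rewrite lerDl.
  by apply: iter_Kop_le1 => C; case: (goal' C).
by rewrite iter_Kop_addc lerD2r.
Qed.

End Kernel.

(** * One round: hits, weights and reciprocals *)

Section OneRound.
Variables (R : realType) (q : R) (n : nat) (G : rel 'I_n).
Hypothesis q01 : 0 <= q <= 1.
Variables (P : protocol) (A : {set 'I_n}).
Implicit Types (B : {set 'I_n}) (f : {ffun 'I_n -> 'I_n * bool}).

Let pull : bool := if P is PushPull then true else false.
Let w := call_weight q G.
Let w0 : forall v t, 0 <= w v t := call_weight_ge0 G q01.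
Let w1 : forall v, \sum_t w v t = 1 := call_weight_sum1 q G.

(** Each success is charged to the caller, a pull to [u] itself. For u outside A, [hits] is thus a
    sum over independent calls, to which the second moment bound applies. *)
Definition reaches (v u : 'I_n) (t : 'I_n * bool) : bool :=
  t.2 && (((v \in A) && (t.1 == u)) || [&& pull, v == u & t.1 \in A]).

Definition hits f (u : 'I_n) : R := \sum_v (reaches v u (f v))%:R.

Definition hit_rate (u : 'I_n) : R :=
  q * (\sum_(v in A) choice_weight R G v u +
       (if pull then \sum_(v in A) choice_weight R G u v else 0)).

Lemma in_inform f u : u \notin A ->
  (u \in inform P A f) = [exists v, reaches v u (f v)].
Proof.
move=> uA; rewrite /inform /next_informed /reaches /pull; case: P.
  rewrite !inE (negbTE uA) /=; apply: eq_existsb => v; rewrite !ffunE.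
  by rewrite orbF andbCA.
rewrite !inE (negbTE uA) /= !ffunE.
apply/idP/idP => [/orP[/existsP[v]|/andP[su cu]]|/existsP[v /andP[sv]]].
- by rewrite !ffunE => /and3P[vA sv cv]; apply/existsP; exists v; rewrite sv vA cv.
- by apply/existsP; exists u; rewrite su cu eqxx orbT.
case/orP => [/andP[vA cv]|/andP[/eqP <- cv]].
  by apply/orP; left; apply/existsP; exists v; rewrite !ffunE vA sv cv.
by rewrite sv cv orbT.
Qed.

(* If u is hit, this is (1 - th * H)^2 >= 0; unlike a union bound it is
   quadratic in H, and the free th keeps it useful for large rates. *)
Lemma hits_le f (u : 'I_n) (th : R) : u \notin A ->
  2 * th * hits f u - th ^+ 2 * hits f u ^+ 2 <= (u \in inform P A f)%:R.
Proof.
move=> uA; rewrite in_inform //; case: existsP => [_|no] /=.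
  by have := sqr_ge0 (1 - th * hits f u); nra.
have -> : hits f u = 0.
  rewrite /hits big1 // => v _; case: (boolP (reaches v u (f v))) => // rv.
  by case: no; exists v.
by rewrite expr0n /= !mulr0 subr0.
Qed.

Lemma in_inform_le_hits f (u : 'I_n) : u \notin A ->
  (u \in inform P A f)%:R <= hits f u.
Proof.
move=> uA; rewrite in_inform //; case: existsP => [[v rv]|_] /=.
  by rewrite /hits (bigD1 v) //= rv lerDl sumr_ge0.
exact: sumr_ge0.
Qed.

Lemma sum_marg_reaches u : u \notin A ->
  \sum_v marg w v (fun t => (reaches v u t)%:R) = hit_rate u.
Proof.
move=> uA.
transitivity (\sum_v ((if v \in A then q * choice_weight R G v u else 0) +
  (if v == u then q * (if pull then \sum_(x in A) choice_weight R G u x else 0) else 0))).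
  apply: eq_bigr => v _; rewrite /marg.
  rewrite (sum_call_weight q G v (fun c b =>
    (b && (((v \in A) && (c == u)) || [&& pull, v == u & c \in A]))%:R)) /=.
  rewrite (eq_bigr (fun c => choice_weight R G v c *
    (q * (((v \in A) && (c == u)) || [&& pull, v == u & c \in A])%:R))); last first.
    by move=> c _; rewrite mulr0 addr0.
  have [->|/negbTE vu] : v = u \/ v != u by case: (eqVneq v u); [left|right].
    rewrite eqxx (negbTE uA) /= add0r; case: (pull); last first.
      by rewrite [RHS]mulr0 big1 // => x _; rewrite !mulr0.
    rewrite mulr_sumr [RHS]big_mkcond /=; apply: eq_bigr => x _.
    by case: (x \in A); rewrite ?mulr1 ?mulr0 // mulrC.
  rewrite vu [RHS]addr0; case: (v \in A) => /=; last first.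
    by rewrite big1 // => x _; rewrite andbF !mulr0.
  rewrite (bigD1 u) //= eqxx /= [X in _ + X]big1; last first.
    by move=> x /negbTE ->; rewrite andbF !mulr0.
  by rewrite [LHS]addr0 [q * _]mulr1 mulrC.
rewrite big_split /= -!big_mkcond /= big_pred1_eq -mulr_sumr /hit_rate mulrDr.
by [].
Qed.

Lemma pexp_hits u : u \notin A -> pexp w (fun f => hits f u) = hit_rate u.
Proof.
move=> uA; rewrite -sum_marg_reaches // /hits pexp_sum; apply: eq_bigr => v _.
by rewrite (pexp_coord w1 v (fun t => (reaches v u t)%:R)).
Qed.

Lemma pexp_hits2 u : u \notin A ->
  pexp w (fun f => hits f u ^+ 2) <= hit_rate u + hit_rate u ^+ 2.
Proof.
move=> uA; have := pexp_second_moment w1 (fun v t => (reaches v u t)%:R).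
rewrite sum_marg_reaches //.
have -> : \sum_v marg w v (fun t => (reaches v u t)%:R ^+ 2) = hit_rate u.
  rewrite -sum_marg_reaches //; apply: eq_bigr => v _; apply: eq_bigr => t _.
  by case: (reaches v u t); rewrite ?expr1n ?expr0n.
by [].
Qed.

Definition wsum (h : 'I_n -> R) B : R := \sum_(v in B) h v.

Lemma wsum_inform h f :
  wsum h (inform P A f) = wsum h A + \sum_(u | u \notin A) h u * (u \in inform P A f)%:R.
Proof.
rewrite /wsum (bigID (mem A)) /=; congr (_ + _).
  apply: eq_bigl => v; case: (boolP (v \in A)) => vA; rewrite ?andbF //= andbT.
  by apply: (fintype.subsetP (subset_inform P A f)).
rewrite big_mkcond [RHS]big_mkcond /=; apply: eq_bigr => v _.
by case: (v \in A); case: (v \in inform P A f); rewrite /= ?mulr1 ?mulr0.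
Qed.

Lemma Kop_wsum_ge (h : 'I_n -> R) (th : R) :
  (forall u, 0 <= h u) ->
  wsum h A + \sum_(u | u \notin A) h u *
    (2 * th * hit_rate u - th ^+ 2 * (hit_rate u + hit_rate u ^+ 2))
  <= Kop q G P (wsum h) A.
Proof.
move=> h0; rewrite /Kop.
rewrite (eq_pexp _ (H := fun f => wsum h A +
   \sum_(u | u \notin A) h u * (u \in inform P A f)%:R)); last first.
  by move=> f; exact: wsum_inform.
rewrite (pexpD _ (fun=> wsum h A)) pexp_cst // pexp_sum lerD2l.
apply: ler_sum => u uA; rewrite pexpZ ler_wpM2l //.
apply: le_trans (_ : pexp w (fun f => 2 * th * hits f u + (- th ^+ 2) * hits f u ^+ 2) <= _).
  rewrite pexpD !pexpZ pexp_hits // mulNr lerD2l lerN2.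
  by rewrite ler_wpM2l ?sqr_ge0 ?pexp_hits2.
by apply: ler_pexp => // f; rewrite mulNr; exact: hits_le.
Qed.

Lemma Kop_wsum_le (h : 'I_n -> R) :
  (forall u, 0 <= h u) ->
  Kop q G P (wsum h) A <= wsum h A + \sum_(u | u \notin A) h u * hit_rate u.
Proof.
move=> h0; rewrite /Kop.
rewrite (eq_pexp _ (H := fun f => wsum h A +
   \sum_(u | u \notin A) h u * (u \in inform P A f)%:R)); last first.
  by move=> f; exact: wsum_inform.
rewrite (pexpD _ (fun=> wsum h A)) pexp_cst // pexp_sum lerD2l.
apply: ler_sum => u uA; rewrite pexpZ ler_wpM2l // -pexp_hits //.
by apply: ler_pexp => // f; exact: in_inform_le_hits.
Qed.

Let reach_weight (h : 'I_n -> R) v t : R :=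
  \sum_(u | u \notin A) h u * (reaches v u t)%:R.

Lemma sum_reach_weight h f :
  \sum_v reach_weight h v (f v) = \sum_(u | u \notin A) h u * hits f u.
Proof.
rewrite /reach_weight exchange_big /=; apply: eq_bigr => u _.
by rewrite /hits mulr_sumr.
Qed.

(** A call reaches at most one uninformed vertex [u0]: the callee if the caller is informed, the
    caller itself otherwise. *)
Lemma reach_weight_01 h v t : (forall u, 0 <= h u <= 1) -> 0 <= reach_weight h v t <= 1.
Proof.
move=> h01; apply/andP; split.
  by apply: sumr_ge0 => u _; rewrite mulr_ge0 //; case/andP: (h01 u).
pose u0 := if v \in A then t.1 else v.
rewrite /reach_weight.
have z u : u \notin A -> u != u0 -> reaches v u t = false.
  move=> uA; rewrite /u0 /reaches; case: (boolP (v \in A)) => vA uu0 /=.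
    rewrite eq_sym (negbTE uu0) /=; case: (eqVneq v u) => [e|]; last by rewrite !andbF.
    by rewrite e (negbTE uA) in vA.
  by rewrite eq_sym (negbTE uu0) /= !andbF.
case: (boolP (u0 \in A)) => u0A.
  rewrite big1 // => u uA; rewrite z ?mulr0 //.
  by apply: contraNneq uA => ->.
rewrite (bigD1 u0) //= big1 ?addr0; last by move=> u /andP[uA uu0]; rewrite z ?mulr0.
case/andP: (h01 u0) => h0 h1.
by case: (reaches _ _ _); rewrite ?mulr1 ?mulr0.
Qed.

(* With Z the informed weight counted with multiplicity, X <= Z: 1/X exceeds
   1/Z by at most (Z - X)/S^2, and 1/Z lies below its second order expansion
   at the mean M of Z. *)
Lemma Kop_inv_wsum (h : 'I_n -> R) :
  (forall u, 0 <= h u <= 1) -> 0 < wsum h A ->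
  Kop q G P (fun B => (wsum h B)^-1) A <=
    (wsum h A + \sum_(u | u \notin A) h u * hit_rate u)^-1
    + (\sum_(u | u \notin A) h u * hit_rate u) / wsum h A ^+ 3
    + (\sum_(u | u \notin A) h u * hit_rate u ^+ 2) / wsum h A ^+ 2.
Proof.
move=> h01 S0; set S := wsum h A; set g := \sum_(u | _) _ * hit_rate _.
have h0 u : 0 <= h u by case/andP: (h01 u).
have hr0 u : 0 <= hit_rate u.
  case/andP: q01 => q0 _; rewrite /hit_rate mulr_ge0 // addr_ge0 //.
    by apply: sumr_ge0 => v _; exact: choice_weight_ge0.
  by case: (pull) => //; apply: sumr_ge0 => v _; exact: choice_weight_ge0.
have g0 : 0 <= g by apply: sumr_ge0 => u _; rewrite mulr_ge0.
set M := S + g; have SM : S <= M by rewrite lerDl.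
have M0 : 0 < M by exact: lt_le_trans SM.
pose Z f := S + \sum_v reach_weight h v (f v).
have sm : \sum_v marg w v (reach_weight h v) = g.
  rewrite -[RHS](eq_bigr _ (fun u uA => congr1 ( *%R (h u)) (pexp_hits uA))).
  under [RHS]eq_bigr do rewrite -pexpZ.
  rewrite -pexp_sum.
  rewrite -[RHS](eq_pexp w (F := fun f => \sum_v reach_weight h v (f v))).
    by rewrite pexp_sum; apply: eq_bigr => v _; rewrite pexp_coord.
  by move=> f; rewrite sum_reach_weight.
have EZ : pexp w Z = M.
  by rewrite (pexpD _ (fun=> S)) pexp_cst // pexp_sum /M -sm; congr (_ + _);
     apply: eq_bigr => v _; rewrite pexp_coord.
(* The summands lie in [0, 1], so their second moments are at most their means. *)
have var : pexp w (fun f => (Z f - M) ^+ 2) <= g.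
  apply: le_trans (pexp_variance w1 _) _; first by rewrite sm.
  rewrite -sm; apply: ler_sum => v _; apply: ler_marg => // t.
  by have /andP[a b] := reach_weight_01 v t h01; rewrite expr2 ler_piMl.
(* [L] dominates the multiplicity excess: [hits_le] with th = 1 says H - 1 <= H^2 - H on a hit.
   Unlike the excess, its mean is computable and quadratic in the rates. *)
pose L f := \sum_(u | u \notin A) h u * (hits f u ^+ 2 - hits f u).
have EL : pexp w L <= \sum_(u | u \notin A) h u * hit_rate u ^+ 2.
  rewrite pexp_sum; apply: ler_sum => u uA; rewrite pexpZ ler_wpM2l //.
  rewrite (eq_pexp _ (H := fun f => hits f u ^+ 2 + -1 * hits f u)); last first.
    by move=> f; rewrite mulN1r.
  by rewrite pexpD pexpZ pexp_hits // mulN1r lerBlDr addrC pexp_hits2.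
have pt f : (wsum h (inform P A f))^-1 <=
    M^-1 + (- (M ^- 2)) * (Z f - M) + S ^- 3 * (Z f - M) ^+ 2 + S ^- 2 * L f.
  set X := wsum h _.
  have SX : S <= X.
    rewrite /X wsum_inform lerDl; apply: sumr_ge0 => u _.
    by rewrite mulr_ge0.
  have XZ : X <= Z f.
    rewrite /X wsum_inform /Z sum_reach_weight lerD2l; apply: ler_sum => u uA.
    by rewrite ler_wpM2l // in_inform_le_hits.
  have ZXL : Z f - X <= L f.
    rewrite /X wsum_inform /Z sum_reach_weight opprD addrACA subrr add0r.
    rewrite -sumrB; apply: ler_sum => u uA; rewrite -mulrBr ler_wpM2l //.
    by have := @hits_le f u 1 uA; rewrite expr1n; lra.
  move: SX XZ ZXL; move: (Z f) (L f) X => z l x SX XZ ZXL.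
  have x0 : 0 < x by exact: lt_le_trans SX.
  have z0 : 0 < z by exact: lt_le_trans XZ.
  apply: le_trans (_ : z^-1 + S ^- 2 * l <= _); last first.
    rewrite lerD2r.
    (* An exact expansion at M with remainder (z - M)^2 / (z M^2), where z M^2 >= S^3; the linear
       term vanishes in mean. *)
    have -> : z^-1 = M^-1 + - M ^- 2 * (z - M) + (z * M ^+ 2)^-1 * (z - M) ^+ 2.
      by field; rewrite !gt_eqF.
    rewrite lerD2l ler_wpM2r ?sqr_ge0 // lef_pV2 ?posrE ?exprn_gt0 ?mulr_gt0 ?exprn_gt0 //.
    rewrite (exprS S 2); apply: ler_pM; rewrite ?sqr_ge0 ?(ltW S0) ?(le_trans SX XZ) //.
    by rewrite lerXn2r ?nnegrE ?(ltW S0) ?(ltW M0).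
  have -> : x^-1 = z^-1 + (x * z)^-1 * (z - x) by field; rewrite !gt_eqF.
  rewrite lerD2l; apply: ler_pM; rewrite ?subr_ge0 ?invr_ge0 ?mulr_ge0 ?(ltW x0) ?(ltW z0) //.
  rewrite lef_pV2 ?posrE ?mulr_gt0 ?exprn_gt0 // expr2.
  by apply: ler_pM; rewrite ?(ltW S0) // (le_trans SX).
apply: le_trans (ler_pexp w0 pt) _.
rewrite !pexpD !pexpZ pexp_cst //.
have -> : pexp w (fun f => Z f - M) = 0.
  by rewrite (pexpD _ Z (fun=> - M)) pexp_cst // EZ subrr.
rewrite mulr0 addr0 [g / _]mulrC [X in _ <= _ + X]mulrC.
by rewrite lerD // ?lerD2l ler_wpM2l // invr_ge0 exprn_ge0 // ltW.
Qed.

End OneRound.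

Definition growth_factor (P : protocol) : nat := if P is PushPull then 2 else 1.

(** * Growth rates in the thinned graph *)

Section Rates.
Variables (R : realType) (q eps k D : R) (n : nat) (G Gt : rel 'I_n).
Hypotheses (q01 : 0 < q <= 1) (eps0 : 0 < eps) (k0 : 0 < k) (k2 : k <= 1 / 2)
  (keps : k <= eps / 4) (eps2 : eps <= 1 / 2).
Hypothesis prG : pseudorandom G D k.
Hypothesis kfG : keeps_fraction eps G Gt.
Implicit Types (P : protocol) (A B : {set 'I_n}).

Let q01' : 0 <= q <= 1. Proof. by case/andP: q01 => /ltW -> ->. Qed.
Let D0 : 0 < D. Proof. by case: prG. Qed.
Let symGt : symmetric Gt. Proof. by case: kfG => -[]. Qed.

Lemma adj_kept v u : (Gt v u)%:R <= (G v u)%:R :> R.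
Proof.
case: kfG => _ sub _; case: (boolP (Gt v u)) => [/sub ->//|_].
by rewrite ler0n.
Qed.

Lemma deg_kept_ge v : (1 / 2 + eps) * ((1 - k) * D) <= (deg Gt v)%:R.
Proof.
case: kfG => _ _ /(_ v); apply: le_trans.
case: prG => _ /(_ v) /andP[h _] _ _.
by rewrite ler_wpM2l // addr_ge0 ?ltW // divr_ge0.
Qed.

Lemma deg_kept_ge4 v : D / 4 <= (deg Gt v)%:R.
Proof.
apply: le_trans (deg_kept_ge v).
have h : D / 2 <= (1 - k) * D by have := ler_wpM2l (ltW D0) k2; lra.
have h0 : 0 <= (1 - k) * D by apply: le_trans h; rewrite divr_ge0 // ltW.
have := mulr_ge0 (ltW eps0) h0; lra.
Qed.

Lemma deg_kept_le v : (deg Gt v)%:R <= D.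
Proof.
case: prG => _ /(_ v) /andP[_ h] _ _; apply: le_trans h.
by rewrite -!sum_adj; apply: ler_sum => u _; exact: adj_kept.
Qed.

Lemma deg_kept_gt0 v : 0 < (deg Gt v)%:R :> R.
Proof. by apply: lt_le_trans (deg_kept_ge4 v); rewrite divr_gt0. Qed.

Lemma choice_weightE v u : choice_weight R Gt v u = (Gt v u)%:R / (deg Gt v)%:R.
Proof. by rewrite /choice_weight -(pnatr_eq0 R) gt_eqF // deg_kept_gt0. Qed.

Lemma choice_weight_le v u : choice_weight R Gt v u <= 4 / D * (G v u)%:R.
Proof.
rewrite choice_weightE mulrC; apply: ler_pM; rewrite ?invr_ge0 ?ler0n ?adj_kept //.
rewrite -[leRHS]invrK lef_pV2 ?posrE ?deg_kept_gt0 //; last first.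
  by rewrite invr_gt0 divr_gt0.
by rewrite invf_div deg_kept_ge4.
Qed.

Lemma choice_weight_ge v u : (Gt v u)%:R / D <= choice_weight R Gt v u.
Proof.
by rewrite choice_weightE ler_wpM2l // lef_pV2 ?posrE ?deg_kept_gt0 ?deg_kept_le.
Qed.

(** Degrees contribute at least (1/2 + eps)(1 - k) D per vertex of B, inner edges at most (1/2 + k)
    D because |B| <= n/2. The surplus is at least (eps - 2k) D, hence eps D/2 by k <= eps/4. *)
Lemma crossing_edges B : 2 * #|B|%:R <= n%:R :> R ->
  eps / 2 * D * #|B|%:R <= \sum_(v in B) \sum_(u | u \notin B) (Gt v u)%:R.
Proof.
move=> hB; set b : R := #|B|%:R.
case: prG => _ _ /(_ B) inner _.
have tot : (1 / 2 + eps) * ((1 - k) * D) * b <= \sum_(v in B) \sum_u (Gt v u)%:R.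
  rewrite /b -sum1_card natr_sum mulr_sumr; apply: ler_sum => v _.
  by rewrite mulr1 sum_adj deg_kept_ge.
have spl : \sum_(v in B) \sum_u (Gt v u)%:R =
    \sum_(v in B) \sum_(u in B) (Gt v u)%:R +
    \sum_(v in B) \sum_(u | u \notin B) (Gt v u)%:R :> R.
  by rewrite -big_split /=; apply: eq_bigr => v _; rewrite (bigID (mem B)).
have inn : \sum_(v in B) \sum_(u in B) (Gt v u)%:R <= D * (b ^+ 2 / n%:R + k * b).
  apply: le_trans inner; apply: ler_sum => v _; apply: ler_sum => u _.
  exact: adj_kept.
have b0 : 0 <= b by rewrite ler0n.
have bn : b ^+ 2 / n%:R <= b / 2.
  have [->|n0] := eqVneq n 0%N; first by rewrite invr0 mulr0 divr_ge0.
  rewrite ler_pdivrMr ?ltr0n ?lt0n // expr2 -mulrA ler_wpM2l //.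
  by move: hB; rewrite -/b; lra.
have Db : 0 <= D * b by rewrite mulr_ge0 // ltW.
have h1 : D * (b ^+ 2 / n%:R) <= D * b / 2.
  by rewrite -mulrA ler_wpM2l // ltW.
have h2 : D * b * k <= D * b * (eps / 4) by rewrite ler_wpM2l.
have h3 : D * b * (k * eps) <= D * b * (k * (1 / 2)).
  by rewrite ler_wpM2l // ler_wpM2l // ltW.
move: spl tot inn; set S1 := \sum_(v in B) \sum_(u in B) _.
set S2 := \sum_(v in B) \sum_(u | _) _ => ->.
have -> : (1 / 2 + eps) * ((1 - k) * D) * b =
  D * b / 2 + eps * (D * b) - D * b * k / 2 - D * b * (k * eps) by field.
rewrite mulrDr; move: h1; set Y := D * (b ^+ 2 / _).
have -> : eps / 2 * D * b = D * b * eps / 2 by ring.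
lra.
Qed.

(** Counted in G and not in [Gt], so that the pseudorandom bounds apply directly. *)
Definition nbr (A : {set 'I_n}) (u : 'I_n) : R := \sum_(v in A) (G v u)%:R.

Lemma nbr_ge0 A u : 0 <= nbr A u.
Proof. by apply: sumr_ge0 => v _; rewrite ler0n. Qed.

Lemma hit_rate_ge0 P A u : 0 <= hit_rate q Gt P A u.
Proof.
case/andP: q01' => q0 _; rewrite /hit_rate mulr_ge0 // addr_ge0 //.
  by apply: sumr_ge0 => v _; exact: choice_weight_ge0.
by case: P => //; apply: sumr_ge0 => v _; exact: choice_weight_ge0.
Qed.

Lemma push_rate_le A u : \sum_(v in A) choice_weight R Gt v u <= 4 / D * nbr A u.
Proof. by rewrite mulr_sumr; apply: ler_sum => v _; exact: choice_weight_le. Qed.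

Hypothesis symG : symmetric G.

Lemma pull_rate_le A u : \sum_(v in A) choice_weight R Gt u v <= 4 / D * nbr A u.
Proof.
rewrite mulr_sumr; apply: ler_sum => v _; rewrite symG; exact: choice_weight_le.
Qed.

Lemma hit_rate_le P A u : hit_rate q Gt P A u <= 8 / D * nbr A u.
Proof.
case/andP: q01 => q0 q1.
have h := nbr_ge0 A u; have D0i : 0 <= D^-1 by rewrite invr_ge0 ltW.
have h4 : 0 <= 4 / D * nbr A u by rewrite mulr_ge0 // mulr_ge0.
have a := push_rate_le A u; have b := pull_rate_le A u.
have -> : 8 / D * nbr A u = 1 * (4 / D * nbr A u + 4 / D * nbr A u) by ring.
rewrite /hit_rate; apply: ler_pM => //; first exact: ltW.
- by have := hit_rate_ge0 P A u; rewrite /hit_rate pmulr_rge0.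
- by apply: lerD => //; case: P.
Qed.

Lemma push_hit_rate A u : hit_rate q Gt Push A u = q * \sum_(v in A) choice_weight R Gt v u.
Proof. by rewrite /hit_rate addr0. Qed.

Lemma push_hit_rate_le4 A u : hit_rate q Gt Push A u <= 4.
Proof.
case/andP: q01 => q0 q1; rewrite push_hit_rate.
have -> : 4 = 1 * (4 / D * D) by field; rewrite gt_eqF.
apply: ler_pM; rewrite ?(ltW q0) //.
  by apply: sumr_ge0 => v _; exact: choice_weight_ge0.
apply: le_trans (push_rate_le A u) _; rewrite ler_wpM2l ?divr_ge0 ?(ltW D0) //.
case: prG => _ /(_ u) /andP[_ h] _ _; apply: le_trans h.
rewrite -sum_adj [leRHS](bigID (mem A)) /= -[leLHS]addr0; apply: lerD.
  by apply: ler_sum => v _; rewrite symG.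
by apply: sumr_ge0.
Qed.

Lemma wsum1 B : wsum (fun=> 1 : R) B = #|B|%:R.
Proof. by rewrite /wsum sumr_const. Qed.

Lemma Kop_push_card_ge A :
  #|A|%:R + q / (5 * D) * \sum_(u | u \notin A) \sum_(v in A) (Gt v u)%:R <=
  Kop q Gt Push (fun B => #|B|%:R) A.
Proof.
case/andP: q01 => q0 q1.
(* With th = 1/5 and a rate x <= 4, 2 th x - th^2 (x + x^2) >= x/5, since 1 + x <= 5. *)
have := @Kop_wsum_ge R q n Gt q01' Push A (fun=> 1) (1 / 5) (fun=> ler01).
have -> : Kop q Gt Push (wsum (fun=> 1)) A = Kop q Gt Push (fun B => #|B|%:R) A.
  by apply: eq_pexp => f; rewrite wsum1.
apply: le_trans; rewrite wsum1 lerD2l mulr_sumr; apply: ler_sum => u _.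
have h0 := hit_rate_ge0 Push A u; have h4 := push_hit_rate_le4 A u.
apply: le_trans (_ : hit_rate q Gt Push A u / 5 <= _); last by nra.
rewrite push_hit_rate.
have -> : q / (5 * D) * \sum_(v in A) (Gt v u)%:R = q * (\sum_(v in A) (Gt v u)%:R / D) / 5.
  by rewrite -mulr_suml; field; rewrite gt_eqF.
rewrite ler_wpM2r // ler_wpM2l ?(ltW q0) //.
by apply: ler_sum => v _; exact: choice_weight_ge.
Qed.

Lemma Kop_push_card_le A : Kop q Gt Push (fun B => #|B|%:R) A <= (1 + q) * #|A|%:R.
Proof.
case/andP: q01 => q0 q1.
have := @Kop_wsum_le R q n Gt q01' Push A (fun=> 1) (fun=> ler01).
have -> : Kop q Gt Push (wsum (fun=> 1)) A = Kop q Gt Push (fun B => #|B|%:R) A.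
  by apply: eq_pexp => f; rewrite wsum1.
move=> h; apply: le_trans h _; rewrite wsum1 mulrDl mul1r lerD2l.
under eq_bigr do rewrite mul1r push_hit_rate.
rewrite -mulr_sumr ler_wpM2l ?(ltW q0) // exchange_big /=.
rewrite -sum1_card natr_sum; apply: ler_sum => v _.
rewrite -[leRHS](choice_weight_sum1 R Gt v) [leRHS](bigID (fun u => u \notin A)) /=.
by rewrite lerDl; apply: sumr_ge0 => u _; exact: choice_weight_ge0.
Qed.

(** Coupling: both protocols are run on the same calls. *)
Lemma Kop_card_push_le P A :
  Kop q Gt Push (fun B => #|B|%:R) A <= Kop q Gt P (fun B => #|B|%:R) A.
Proof.
case: P => //; apply: ler_pexp => [|f]; first exact: call_weight_ge0.
by rewrite ler_nat subset_leq_card // inform_push_sub.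
Qed.

Lemma Kop_card_ge_early P A : 2 * #|A|%:R <= n%:R :> R ->
  (1 + q * eps / 10) * #|A|%:R <= Kop q Gt P (fun B => #|B|%:R) A.
Proof.
case/andP: q01 => q0 q1.
move=> hA; apply: le_trans (Kop_card_push_le P A).
apply: le_trans (Kop_push_card_ge A); rewrite exchange_big /= mulrDl mul1r lerD2l.
have := crossing_edges hA => h.
apply: le_trans (_ : q / (5 * D) * (eps / 2 * D * #|A|%:R) <= _).
  by rewrite le_eqVlt; apply/orP; left; apply/eqP; field; rewrite gt_eqF.
by rewrite ler_wpM2l // divr_ge0 ?(ltW q0) ?mulr_ge0 ?(ltW D0).
Qed.

(** Here the complement has at most half of the vertices, and [crossing_edges] applies to it;
    symmetry of [Gt] turns its boundary around. *)
Lemma Kop_card_ge_late P A : n%:R <= 2 * #|A|%:R :> R ->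
  #|A|%:R + q * eps / 10 * (n%:R - #|A|%:R) <= Kop q Gt P (fun B => #|B|%:R) A.
Proof.
case/andP: q01 => q0 q1.
move=> hA; apply: le_trans (Kop_card_push_le P A).
apply: le_trans (Kop_push_card_ge A); rewrite lerD2l.
have cC : #|~: A|%:R = n%:R - #|A|%:R :> R.
  by have /(congr1 (fun m => m%:R : R)) := cardsC A; rewrite card_ord natrD; lra.
have hC : 2 * #|~: A|%:R <= n%:R :> R by rewrite cC; lra.
have := crossing_edges hC => h.
apply: le_trans (_ : q / (5 * D) * (eps / 2 * D * #|~: A|%:R) <= _).
  by rewrite cC le_eqVlt; apply/orP; left; apply/eqP; field; rewrite gt_eqF.
rewrite ler_wpM2l // ?divr_ge0 ?(ltW q0) ?mulr_ge0 ?(ltW D0) //.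
apply: le_trans h _; rewrite le_eqVlt; apply/orP; left; apply/eqP.
rewrite (eq_bigl (fun u => u \notin A)); last by move=> u; rewrite inE.
apply: eq_bigr => u _; rewrite (eq_bigl (fun u => u \in A)); last first.
  by move=> v; rewrite inE negbK.
by apply: eq_bigr => v _; rewrite symGt.
Qed.

Lemma Kop_uninformed_late P A : n%:R <= 2 * #|A|%:R :> R ->
  Kop q Gt P (fun B => n%:R - #|B|%:R) A <=
    (1 - q * eps / 10) * (n%:R - #|A|%:R).
Proof.
move=> hA; have := Kop_card_ge_late P hA.
have -> : Kop q Gt P (fun B => n%:R - #|B|%:R) A =
   n%:R - Kop q Gt P (fun B => #|B|%:R) A.
  rewrite -mulN1r -KopZ addrC -Kop_addc.
  by apply: eq_pexp => f; rewrite mulN1r addrC.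
lra.
Qed.

Lemma card_inform_push A f : (#|inform Push A f| <= 2 * #|A|)%N.
Proof.
rewrite /inform /next_informed mul2n -addnn.
apply: leq_trans (leq_card_setU _ _) _; rewrite leq_add2l.
apply: leq_trans (leq_imset_card (fun v => (f v).1) (mem A)).
apply: subset_leq_card; apply/fintype.subsetP => u; rewrite inE.
case/existsP => v /and3P[vA _]; rewrite !ffunE => /eqP <-.
exact: imset_f.
Qed.

(* On [a, 2a] the convex function 1/x lies below its chord. *)
Lemma Kop_inv_card_early P A : (0 < #|A|)%N -> 2 * #|A|%:R <= n%:R :> R ->
  Kop q Gt P (fun B => #|B|%:R^-1) A <= (1 - q * eps / 20) * #|A|%:R^-1.
Proof.
move=> A0 hA; set a : R := #|A|%:R.
have a0 : 0 < a by rewrite ltr0n.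
(* Only push is sure to stay within [a, 2a]; a round of push&pull can more than double the set. *)
have toPush : Kop q Gt P (fun B => #|B|%:R^-1) A <= Kop q Gt Push (fun B => #|B|%:R^-1 : R) A.
  case: P => //; apply: ler_pexp => [|f]; first exact: call_weight_ge0.
  have c0 : (0 < #|inform Push A f|)%N.
    by apply: leq_trans A0 _; exact: subset_leq_card (subset_inform _ _ _).
  have c1 : (#|inform Push A f| <= #|inform PushPull A f|)%N.
    by apply: subset_leq_card; exact: inform_push_sub.
  by rewrite lef_pV2 ?posrE ?ltr0n ?ler_nat // (leq_trans c0).
apply: le_trans toPush _.
have e := Kop_card_ge_early Push hA.
(* The chord through (a, 1/a) and (2a, 1/(2a)) has slope -1/(2 a^2), so mean growth by q eps/10
   becomes mean shrinkage by q eps/20. *)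
apply: le_trans (_ : Kop q Gt Push (fun B => - (2 * a ^+ 2)^-1 * #|B|%:R + 3 / (2 * a)) A <= _).
  apply: ler_pexp => [|f]; first exact: call_weight_ge0.
  have : a <= #|inform Push A f|%:R.
    by rewrite ler_nat; apply: subset_leq_card; exact: subset_inform.
  have : #|inform Push A f|%:R <= 2 * a by rewrite -natrM ler_nat card_inform_push.
  move: (#|inform Push A f|%:R) => x x2 x1.
  have x0 : 0 < x by exact: lt_le_trans x1.
  rewrite -subr_ge0.
  have -> : - (2 * a ^+ 2)^-1 * x + 3 / (2 * a) - x^-1 =
     (2 * a ^+ 2 * x)^-1 * ((x - a) * (2 * a - x)).
    by field; rewrite !gt_eqF.
  by rewrite mulr_ge0 ?invr_ge0 ?mulr_ge0 ?subr_ge0 ?sqr_ge0 ?(ltW x0).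
rewrite Kop_addc KopZ.
have i0 : 0 <= (2 * a ^+ 2)^-1 by rewrite invr_ge0 mulr_ge0 ?sqr_ge0.
have := ler_wpM2l i0 e; rewrite -/a.
have -> : (1 - q * eps / 20) * a^-1 =
   - ((2 * a ^+ 2)^-1 * ((1 + q * eps / 10) * a)) + 3 / (2 * a).
  by field; rewrite gt_eqF.
by move=> h; rewrite lerD2r mulNr lerN2.
Qed.

(** Division by sqrt D scales the weight into [0, 1], the range needed by [Kop_inv_wsum]; degrees of
    at least D/4 keep it above 1/2. *)
Definition potential P (u : 'I_n) : R :=
  if P is PushPull then Num.sqrt (deg Gt u)%:R / Num.sqrt D else 1.

Lemma potential_bounds P u : 1 / 2 <= potential P u <= 1.
Proof.
rewrite /potential; case: P; first by apply/andP; split; lra.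
have sD : 0 < Num.sqrt D by rewrite sqrtr_gt0.
rewrite ler_pdivlMr // ler_pdivrMr //; apply/andP; split; last first.
  by rewrite mul1r ler_wsqrtr // deg_kept_le.
have h0 : 0 <= 1 / 2 * Num.sqrt D by rewrite mulr_ge0 ?divr_ge0 ?sqrtr_ge0.
rewrite -ler_sqr ?nnegrE ?sqrtr_ge0 // exprMn !sqr_sqrtr ?ler0n ?(ltW D0) //.
by have := deg_kept_ge4 u; lra.
Qed.

(* The degree weights sqrt d(u) make the pair push + pull superharmonic:
   sqrt d(u) * (1/d(v) + 1/d(u)) >= 2 / sqrt d(v) by AM-GM. *)
Lemma potential_growth P A :
  (growth_factor P)%:R * q * wsum (potential P) A <=
    \sum_u potential P u * hit_rate q Gt P A u.
Proof.
case/andP: q01 => q0 q1.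
case: P; rewrite /growth_factor /potential /hit_rate /wsum /=.
  under [leRHS]eq_bigr do rewrite mul1r addr0.
  rewrite mul1r -mulr_sumr ler_wpM2l ?(ltW q0) // exchange_big /=.
  by apply: ler_sum => v _; rewrite choice_weight_sum1.
have sD : 0 < Num.sqrt D by rewrite sqrtr_gt0.
under [leRHS]eq_bigr do rewrite -big_split /= mulrCA mulr_sumr.
rewrite [2 * q]mulrC -mulrA -mulr_sumr ler_wpM2l ?(ltW q0) // exchange_big /= mulr_sumr.
apply: ler_sum => v _.
have sd x : 0 < Num.sqrt ((deg Gt x)%:R : R) by rewrite sqrtr_gt0 deg_kept_gt0.
have dE x : (deg Gt x)%:R = Num.sqrt ((deg Gt x)%:R : R) ^+ 2.
  by rewrite sqr_sqrtr // ler0n.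
have -> : 2 * (Num.sqrt (deg Gt v)%:R / Num.sqrt D) =
  \sum_u (Gt v u)%:R * (2 / (Num.sqrt (deg Gt v)%:R * Num.sqrt D)).
  rewrite -mulr_suml sum_adj; have := dE v; have := sd v.
  by move: (Num.sqrt (deg Gt v)%:R) => y y0 ->; field; rewrite !gt_eqF.
apply: ler_sum => u _; rewrite !choice_weightE (symGt u v) -mulrDr [leRHS]mulrCA ler_wpM2l //.
have := dE v; have := sd v; have := dE u; have := sd u; move: sD.
move: (Num.sqrt (deg Gt u)%:R) (Num.sqrt (deg Gt v)%:R) (Num.sqrt D).
move=> x y z z0 x0 -> y0 ->.
rewrite -subr_ge0.
have -> : x / z * ((y ^+ 2)^-1 + (x ^+ 2)^-1) - 2 / (y * z) = (x - y) ^+ 2 / (x * y ^+ 2 * z).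
  by field; rewrite !gt_eqF.
by rewrite divr_ge0 ?sqr_ge0 // !mulr_ge0 ?sqr_ge0 // ltW.
Qed.

(** The three terms of [Kop_inv_wsum] with x = |A|/n + k and S >= |A|/2. Weight sent back into A
    costs 16 x, the variance 32/|A| and repeated hits 256 x; 272 = 16 + 256. *)
Lemma Kop_inv_potential P A : (0 < #|A|)%N ->
  Kop q Gt P (fun B => (wsum (potential P) B)^-1) A <=
   ((1 + (growth_factor P)%:R * q)^-1 + 272 * (#|A|%:R / n%:R + k) + 32 / #|A|%:R)
   * (wsum (potential P) A)^-1.
Proof.
case/andP: q01 => q0 q1 A0.
set h := potential P; set S := wsum h A; set a : R := #|A|%:R.
have a0 : 0 < a by rewrite ltr0n.
have hb u : 1 / 2 <= h u <= 1 by exact: potential_bounds.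
have h01 u : 0 <= h u <= 1.
  by case/andP: (hb u) => h1 ->; rewrite andbT (le_trans _ h1) // divr_ge0.
have aS : a / 2 <= S.
  rewrite /S /wsum /a -sum1_card natr_sum mulr_suml; apply: ler_sum => u _.
  by case/andP: (hb u).
have S0 : 0 < S by apply: lt_le_trans aS; rewrite divr_gt0.
apply: le_trans (Kop_inv_wsum Gt q01' P h01 S0) _.
rewrite -/S; set hr := hit_rate q Gt P A.
set g := \sum_(u | _) h u * hr u; set l := \sum_(u | _) _.
set x := a / n%:R + k; set r : R := _%:R.
have x0 : 0 <= x by rewrite addr_ge0 ?divr_ge0 ?ler0n ?(ltW k0) ?(ltW a0).
have [_ dG inA sqA] := prG.
have dA u : hr u <= 8 / D * nbr A u by exact: hit_rate_le.
have hr0 u : 0 <= hr u by exact: hit_rate_ge0.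
have D8 : 0 <= 8 / D by rewrite divr_ge0 // ltW.
have hhr u : h u * hr u <= 8 / D * nbr A u.
  by case/andP: (h01 u) => h0 h1; apply: le_trans (dA u); rewrite ler_piMl.
have g0 : 0 <= g by apply: sumr_ge0 => u _; rewrite mulr_ge0 //; case/andP: (h01 u).
have g8 : g <= 8 * a.
  apply: le_trans (_ : \sum_u 8 / D * nbr A u <= _).
    rewrite [leRHS](bigID (fun u => u \notin A)) /= -[leLHS]addr0; apply: lerD.
      by apply: ler_sum => u _.
    by apply: sumr_ge0 => u _; rewrite mulr_ge0 // nbr_ge0.
  rewrite -mulr_sumr exchange_big /=.
  have -> : 8 * a = 8 / D * (a * D) by field; rewrite gt_eqF.
  rewrite ler_wpM2l // /a -sum1_card natr_sum mulr_suml; apply: ler_sum => v _.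
  by rewrite sum_adj mul1r; case/andP: (dG v).
(* [potential_growth] sums over all vertices; the share falling inside A is bounded by the inner
   edge count. *)
have gr : r * q * S - 8 * a * x <= g.
  have := potential_growth P A; rewrite -/h -/S -/r (bigID (mem A)) /=.
  rewrite -/g; set i := \sum_(u in A) _ => hg.
  have : i <= 8 * a * x.
    apply: le_trans (_ : 8 / D * \sum_(u in A) \sum_(v in A) (G u v)%:R <= _).
      rewrite mulr_sumr; apply: ler_sum => u _; apply: le_trans (hhr u) _.
      by rewrite ler_wpM2l //; apply: ler_sum => v _; rewrite symG.
    have -> : 8 * a * x = 8 / D * (D * (a ^+ 2 / n%:R + k * a)).
      by rewrite /x mulrA divfK ?gt_eqF //; ring.
    by rewrite ler_wpM2l // inA.
  lra.
have lx : l <= 128 * a * x.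
  apply: le_trans (_ : \sum_u (8 / D) ^+ 2 * nbr A u ^+ 2 <= _).
    rewrite [leRHS](bigID (fun u => u \notin A)) /= -[leLHS]addr0; apply: lerD.
      apply: ler_sum => u _; case/andP: (h01 u) => h0 h1.
      apply: le_trans (_ : hr u ^+ 2 <= _); first by rewrite ler_piMl ?sqr_ge0.
      by rewrite -exprMn lerXn2r ?nnegrE // mulr_ge0 ?nbr_ge0.
    by apply: sumr_ge0 => u _; rewrite mulr_ge0 ?sqr_ge0.
  rewrite -mulr_sumr.
  have -> : 128 * a * x = (8 / D) ^+ 2 * (2 * D ^+ 2 * (a ^+ 2 / n%:R + k * a)).
    by rewrite /x; move: (n%:R^-1 : R) => ni; field; rewrite gt_eqF.
  by rewrite ler_wpM2l ?sqr_ge0 // sqA.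
have r0 : 0 <= r * q by rewrite mulr_ge0 ?ler0n ?(ltW q0).
have Sg : 0 < S + g by rewrite ltr_pwDl.
have t1 : (S + g)^-1 <= ((1 + r * q)^-1 + 16 * x) * S^-1.
  rewrite -[leLHS]mul1r ler_pdivrMr // mulrAC ler_pdivlMr // mul1r.
  have rq1 : 0 < 1 + r * q by rewrite ltr_pwDl.
  have xa : 8 * a * x <= 16 * x * S.
    by have := ler_wpM2l x0 aS; lra.
  have h2 : S * (1 + r * q) <= (S + g) + 16 * x * S by lra.
  have i0 : 0 <= (1 + r * q)^-1 by rewrite invr_ge0 ltW.
  have i1 : (1 + r * q)^-1 <= 1 by rewrite invf_le1 // lerDl.
  have := ler_wpM2l i0 h2.
  have -> : (1 + r * q)^-1 * (S * (1 + r * q)) = S by field; rewrite gt_eqF.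
  have xS : 0 <= 16 * x * S by rewrite !mulr_ge0 // ltW.
  have := ler_piMl xS i1.
  have : 0 <= 16 * x * g by rewrite !mulr_ge0.
  move: (1 + r * q)^-1 => i; lra.
have t2 : g / S ^+ 3 <= 32 / a * S^-1.
  have -> : g / S ^+ 3 = g / S ^+ 2 * S^-1 by field; rewrite gt_eqF.
  rewrite ler_wpM2r ?invr_ge0 ?(ltW S0) // ler_pdivrMr ?exprn_gt0 //.
  apply: le_trans g8 _.
  have -> : 8 * a = 32 / a * (a / 2) ^+ 2 by field; rewrite gt_eqF.
  by rewrite ler_wpM2l ?divr_ge0 ?(ltW a0) // lerXn2r ?nnegrE ?divr_ge0 ?(ltW a0) ?(ltW S0).
have t3 : l / S ^+ 2 <= 256 * x * S^-1.
  have -> : l / S ^+ 2 = l / S * S^-1 by field; rewrite gt_eqF.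
  rewrite ler_wpM2r ?invr_ge0 ?(ltW S0) // ler_pdivrMr //.
  apply: le_trans lx _.
  have -> : 128 * a * x = 256 * x * (a / 2) by field.
  by rewrite ler_wpM2l // mulr_ge0.
have := lerD (lerD t1 t2) t3.
move=> h'; apply: le_trans h' _.
by rewrite le_eqVlt; apply/orP; left; apply/eqP; ring.
Qed.

End Rates.

(** * The phases and their failure probabilities *)

Section Phases.
Variables (R : realType) (q eps k D : R) (n : nat) (G Gt : rel 'I_n).
Hypotheses (q01 : 0 < q <= 1) (eps0 : 0 < eps) (k0 : 0 < k) (k2 : k <= 1 / 2)
  (keps : k <= eps / 4) (eps2 : eps <= 1 / 2).
Hypothesis prG : pseudorandom G D k.
Hypothesis kfG : keeps_fraction eps G Gt.
Hypothesis symG : symmetric G.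
Variable P : protocol.
Implicit Types (A B : {set 'I_n}).

Let q01' : 0 <= q <= 1. Proof. by case/andP: q01 => /ltW -> ->. Qed.
(** The factor of [Kop_inv_card_early]; the late phase contracts by the smaller 1 - q eps/10 and
    shares it. *)
Let rho : R := 1 - q * eps / 20.
Let at_least (x : R) : pred {set 'I_n} := fun B => x <= #|B|%:R.

Let at_least_mono x A B : A \subset B -> at_least x A -> at_least x B.
Proof. by move=> AB /le_trans; apply; rewrite ler_nat subset_leq_card. Qed.

Let qeps : 0 < q * eps <= 1 / 2.
Proof.
case/andP: q01 => q0 q1; apply/andP; split; first by rewrite mulr_gt0.
by rewrite (le_trans _ eps2) // ler_piMl // ltW.
Qed.

Let rho0 : 0 <= rho. Proof. by rewrite /rho; have /andP[_ h] := qeps; lra. Qed.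

(** Drift for b/|B|. It is used twice, from 1 to K and from g n to n/2, where b/a is a constant and
    o(log n) rounds suffice. *)
Lemma early_phase (a b : R) t A : 0 < a -> 0 <= b <= n%:R / 2 -> a <= #|A|%:R ->
  iter t (Kop q Gt P) (fun B => (~~ (b <= #|B|%:R)%R)%:R) A <= b / a * rho ^+ t.
Proof.
move=> a0 /andP[b0 bn] aA.
have pos B : at_least a B -> 0 < #|B|%:R :> R by exact: lt_le_trans.
have H := @drift R q n Gt q01' P (at_least a) (at_least b) (fun B => b * #|B|%:R^-1) rho
  (@at_least_mono a) (@at_least_mono b) rho0.
apply: le_trans (H _ _ _ t A aA) _.
- by move=> B; rewrite mulr_ge0 ?invr_ge0 ?ler0n.
- move=> B dB; rewrite /at_least -ltNge => gB.
  by rewrite ler_pdivlMr ?pos // mul1r ltW.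
- move=> B dB; rewrite /at_least -ltNge => gB.
  rewrite KopZ mulrCA ler_wpM2l //.
  have B0 : (0 < #|B|)%N by have := pos B dB; rewrite ltr0n.
  have hB : 2 * #|B|%:R <= n%:R :> R by lra.
  exact: (Kop_inv_card_early q01 eps0 k0 k2 keps eps2 prG kfG symG P B0 hB).
rewrite mulrC ler_wpM2r ?exprn_ge0 // ler_wpM2l //.
by rewrite lef_pV2 ?posrE // pos.
Qed.

(** Drift for g n / h(B). The factor 2 in the bound pays for h(A) >= |A|/2 at the start. *)
Lemma middle_phase (K g rho1 : R) t A : 1 <= K -> 0 < g -> 0 <= rho1 ->
  (1 + (growth_factor P)%:R * q)^-1 + 272 * (g + k) + 32 / K <= rho1 ->
  K <= #|A|%:R ->
  iter t (Kop q Gt P) (fun B => (~~ (g * n%:R <= #|B|%:R)%R)%:R) A <=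
    2 * g * n%:R / K * rho1 ^+ t.
Proof.
move=> K1 g0 r0 hr KA; pose h := potential D Gt P.
have n0 : 0 < n%:R :> R.
  have : (#|A| <= n)%N by rewrite -[leqRHS]card_ord max_card.
  by rewrite -(ler_nat R) => hn; lra.
have pos B : at_least K B -> 0 < #|B|%:R :> R by apply: lt_le_trans; lra.
have hb u : 1 / 2 <= h u <= 1 := potential_bounds eps0 k2 prG kfG P u.
have wlo B : #|B|%:R / 2 <= wsum h B.
  rewrite /wsum -sum1_card natr_sum mulr_suml; apply: ler_sum => u _.
  by case/andP: (hb u).
have whi B : wsum h B <= #|B|%:R.
  rewrite /wsum -sum1_card natr_sum; apply: ler_sum => u _.
  by case/andP: (hb u).
have wpos B : at_least K B -> 0 < wsum h B.
  by move=> dB; apply: lt_le_trans (wlo B); rewrite divr_gt0 ?pos.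
have w0 B : 0 <= wsum h B by apply: le_trans (wlo B); rewrite divr_ge0 ?ler0n.
have gn : 0 < g * n%:R by rewrite mulr_gt0.
have H := @drift R q n Gt q01' P (at_least K) (at_least (g * n%:R))
  (fun B => g * n%:R * (wsum h B)^-1) rho1
  (@at_least_mono K) (@at_least_mono (g * n%:R)) r0.
apply: le_trans (H _ _ _ t A KA) _.
- by move=> B; rewrite mulr_ge0 ?invr_ge0 ?w0 // ltW.
- move=> B dB; rewrite /at_least -ltNge => gB.
  by rewrite ler_pdivlMr ?wpos // mul1r (le_trans (whi B)) // ltW.
- move=> B dB; rewrite /at_least -ltNge => gB.
  rewrite KopZ mulrCA ler_wpM2l ?(ltW gn) //.
  have B0 : (0 < #|B|)%N by have := pos B dB; rewrite ltr0n.
  apply: le_trans (Kop_inv_potential q01 eps0 k0 k2 prG kfG symG P B0) _.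
  rewrite ler_wpM2r ?invr_ge0 ?w0 // (le_trans _ hr) //.
  apply: lerD; first rewrite lerD2l ler_wpM2l // lerD2r.
    by rewrite ler_pdivrMr // ltW.
  rewrite ler_wpM2l // lef_pV2 ?posrE ?pos //; lra.
rewrite mulrC ler_wpM2r ?exprn_ge0 //.
have -> : 2 * g * n%:R / K = g * n%:R * (K / 2)^-1 by field; lra.
rewrite ler_wpM2l ?(ltW gn) // lef_pV2 ?posrE ?wpos //; last by lra.
by apply: le_trans (wlo A); rewrite ler_wpM2r.
Qed.

(** Drift for (n - |B|) ln n / n, which exceeds 1 exactly below the threshold n - n/ln n and is at
    most ln n at the start. *)
Lemma late_phase t A : 2 <= ln (n%:R : R) -> n%:R / 2 <= #|A|%:R :> R ->
  iter t (Kop q Gt P) (fun B => (~~ (threshold R n <= #|B|%:R)%R)%:R) A <=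
    ln n%:R * rho ^+ t.
Proof.
move=> l2 nA; set l := ln n%:R; have l0 : 0 < l by rewrite (lt_le_trans _ l2).
have n0 : 0 < n%:R :> R.
  rewrite lt_neqAle ler0n andbT eq_sym; apply/eqP => nz.
  by move: l2; rewrite nz ln0 //; lra.
have cn B : #|B|%:R <= n%:R :> R by rewrite ler_nat -[leqRHS]card_ord max_card.
have H := @drift R q n Gt q01' P (at_least (n%:R / 2)) (at_least (threshold R n))
  (fun B => l / n%:R * (n%:R - #|B|%:R)) rho
  (@at_least_mono _) (@at_least_mono _) rho0.
have ln0' : 0 <= l / n%:R by rewrite divr_ge0 ?ltW.
apply: le_trans (H _ _ _ t A nA) _.
- by move=> B; rewrite mulr_ge0 // subr_ge0.
- move=> B dB; rewrite /at_least -ltNge /threshold -/l => gB.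
  rewrite mulrAC ler_pdivlMr // mul1r mulrC -ler_pdivrMr //.
  by move: gB; set y := n%:R / l; lra.
- move=> B dB _; rewrite KopZ mulrCA ler_wpM2l //.
  have hB : n%:R <= 2 * #|B|%:R :> R by move: dB; rewrite /at_least; lra.
  apply: le_trans (Kop_uninformed_late q01 eps0 k0 k2 keps eps2 prG kfG symG P hB) _.
  by rewrite ler_wpM2r ?subr_ge0 // /rho; have /andP[h _] := qeps; lra.
rewrite mulrC ler_wpM2r ?exprn_ge0 //.
apply: le_trans (_ : l / n%:R * n%:R <= _); last by rewrite divfK // gt_eqF.
by rewrite ler_wpM2l // gerBl ler0n.
Qed.

Lemma not_goal_bound (K g rho1 : R) t0 t1 t2 t3 A :
  1 <= K <= n%:R / 2 -> 0 < g <= 1 / 2 -> 0 <= rho1 ->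
  (1 + (growth_factor P)%:R * q)^-1 + 272 * (g + k) + 32 / K <= rho1 ->
  2 <= ln (n%:R : R) -> 1 <= #|A|%:R :> R ->
  iter (t0 + (t1 + (t2 + t3))) (Kop q Gt P)
      (fun B => (~~ (threshold R n <= #|B|%:R)%R)%:R) A <=
    K * rho ^+ t0 + (2 * g * n%:R / K * rho1 ^+ t1 +
      ((2 * g)^-1 * rho ^+ t2 + ln n%:R * rho ^+ t3)).
Proof.
move=> /andP[K1 Kn] /andP[g0 g2] r0 hr l2 A1.
have n0 : 0 < n%:R :> R by lra.
have p0 t : 0 <= rho ^+ t by rewrite exprn_ge0.
have K0 : 0 < K by lra.
have l0 : 0 <= ln n%:R :> R by lra.
have gn : 0 < g * n%:R by rewrite mulr_gt0.
have b3 : 0 <= ln n%:R * rho ^+ t3 by rewrite mulr_ge0.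
have b2 : 0 <= (2 * g)^-1 * rho ^+ t2 by rewrite mulr_ge0 // invr_ge0 mulr_ge0 // ltW.
have b1 : 0 <= 2 * g * n%:R / K * rho1 ^+ t1.
  by rewrite mulr_ge0 ?exprn_ge0 // divr_ge0 ?(ltW K0) // -mulrA mulr_ge0 // ltW.
apply: (@iter_Kop_chain R q n Gt q01' P (at_least K)); first by rewrite !addr_ge0.
  by rewrite -[K in leRHS]divr1; apply: early_phase => //; rewrite (ltW K0).
move=> B KB.
apply: (@iter_Kop_chain R q n Gt q01' P (at_least (g * n%:R))); first by rewrite addr_ge0.
  exact: middle_phase.
move=> C gC.
apply: (@iter_Kop_chain R q n Gt q01' P (at_least (n%:R / 2))) => //.
  have -> : (2 * g)^-1 = n%:R / 2 / (g * n%:R) by field; rewrite !gt_eqF.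
  by apply: early_phase => //; rewrite lexx andbT divr_ge0 ?ltW.
by move=> E hE; exact: late_phase.
Qed.

End Phases.

(** * Asymptotics and the diagonal argument *)

Lemma ln_ge_near (R : realType) (M : R) : \forall n \near \oo, M <= ln (n%:R : R).
Proof.
near=> n.
have h : expR M <= n%:R by near: n; exact: nbhs_infty_ger.
by rewrite -[M]expRK ler_ln ?posrE ?expR_gt0 // (lt_le_trans _ h) ?expR_gt0.
Unshelve. all: by end_near.
Qed.

Lemma ln_expR_decay (R : realType) (c C e : R) : 0 < c -> 0 <= C -> 0 < e ->
  \forall n \near \oo, C * (ln n%:R * expR (- (c * ln (n%:R : R)))) <= e.
Proof.
move=> c0 C0 e0; near=> n.
have l1 : 1 <= ln (n%:R : R) by near: n; exact: ln_ge_near.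
have : 4 * C / (c ^+ 2 * e) <= ln (n%:R : R) by near: n; exact: ln_ge_near.
move: l1; move: (ln n%:R) => l l1.
have l0 : 0 < l by rewrite (lt_le_trans _ l1).
rewrite ler_pdivrMr ?mulr_gt0 ?exprn_gt0 // => h.
have : (c * l / 2) ^+ 2 <= expR (c * l).
  have -> : expR (c * l) = expR (c * l / 2) ^+ 2.
    by rewrite -expRM_natl; congr expR; field.
  have p : 0 <= c * l / 2 by rewrite divr_ge0 ?mulr_ge0 ?(ltW c0) ?(ltW l0).
  rewrite lerXn2r ?nnegrE ?expR_ge0 //.
  by apply: le_trans (expR_ge1Dx _); rewrite lerDr.
rewrite expRN => h2; rewrite mulrA ler_pdivrMr ?expR_gt0 //.
apply: le_trans (ler_wpM2l (ltW e0) h2).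
have -> : e * (c * l / 2) ^+ 2 = (l * (c ^+ 2 * e)) * l / 4 by field.
have := ler_wpM2r (ltW l0) h; lra.
Unshelve. all: by end_near.
Qed.

(** Rounding y down to a number of rounds costs at most one factor 1/rho. *)
Lemma exprn_le_expR (R : realType) (rho y : R) (t : nat) :
  0 < rho <= 1 -> y - 1 <= t%:R -> rho ^+ t <= rho^-1 * expR (y * ln rho).
Proof.
move=> /andP[r0 r1] yt; rewrite -[rho in leLHS]lnK ?posrE // -expRM_natl.
rewrite -[rho^-1]lnK ?posrE ?invr_gt0 // lnV ?posrE // -expRD ler_expR.
have : ln rho <= 0 by rewrite ln_le0.
nra.
Qed.

(** F need not be monotone in its second argument, so [top n] selects the largest j <= n whose
    tolerance 1/(j+1) is actually met at n. *)
Lemma diagonal_sequence (R : realType) (F : nat -> R -> R) :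
  (forall eta e : R, 0 < eta -> 0 < e -> \forall n \near \oo, `|1 - F n eta| <= e) ->
  exists x : nat -> R,
    [/\ forall n, 0 < x n, x @ \oo --> (0 : R) & (fun n => F n (x n)) @ \oo --> (1 : R)].
Proof.
move=> H; pose r (j : nat) : R := j.+1%:R^-1.
have r0 j : 0 < r j by rewrite invr_gt0 ltr0n.
pose good j n := `[< `|1 - F n (r j)| <= r j >].
pose top n := \max_(j < n.+1 | good j n) (j : nat).
have topP n : good (top n) n \/ top n = 0%N.
  rewrite /top; case: (boolP [exists j : 'I_n.+1, good j n]) => [/existsP[j0 gj]|no].
    left; have [|j gj' ->] := @eq_bigmax_cond _ (fun j : 'I_n.+1 => good j n)
      (fun j : 'I_n.+1 => (j : nat)); last by [].
    by apply/card_gt0P; exists j0.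
  right; rewrite big_pred0 // => j; apply/negbTE.
  by apply: contra no => gj; apply/existsP; exists j.
have top_ge j : \forall n \near \oo, (j <= top n)%N /\ good (top n) n.
  near=> n.
  have jn : (j.+1 <= n)%N by near: n; exists j.+1.
  (* Taking [j.+1] forces [top n] > 0, which excludes the value 0 of an empty maximum. *)
  have gj : good j.+1 n by apply/asboolP; near: n; exact: H.
  have le : (j.+1 <= top n)%N.
    by apply: (@leq_bigmax_cond _ _ (fun i : 'I_n.+1 => (i : nat)) (Ordinal (jn : (j.+1 < n.+1)%N))).
  split; first exact: ltnW.
  by case: (topP n) => // z; rewrite z in le.
have small (e : R) : 0 < e -> \forall n \near \oo, r (top n) <= e /\ good (top n) n.
  move=> e0; pose j := Num.truncn (e^-1).
  have hj : e^-1 <= j.+1%:R.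
    by have /andP[_ /ltW] := truncn_itv (ltW (etrans (invr_gt0 e) e0)).
  near=> n.
  have [h1 h2] : (j <= top n)%N /\ good (top n) n by near: n; exact: top_ge.
  split=> //; rewrite /r -[e]invrK lef_pV2 ?posrE ?ltr0n ?invr_gt0 //.
  by apply: le_trans hj _; rewrite ler_nat.
exists (fun n => r (top n)); split=> //.
  apply/cvgrPdist_le => e e0; near=> n; rewrite sub0r normrN gtr0_norm //.
  have [] : r (top n) <= e /\ good (top n) n by near: n; exact: small.
  by [].
apply/cvgrPdist_le => e e0; near=> n.
have [h /asboolP h2] : r (top n) <= e /\ good (top n) n by near: n; exact: small.
exact: le_trans h2 h.
Unshelve. all: by end_near.
Qed.

(** * Bounds with high probability for a fixed slack eta *)

Lemma prob_T_le_nat_compl (R : realType) (q : R) (P : protocol) (n : nat) (G : rel 'I_n)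
    (S0 : {set 'I_n}) (t : nat) :
  prob_T_le_nat q P G S0 t =
  1 - iter t (Kop q G P) (fun B => (~~ (threshold R n <= #|B|%:R)%R)%:R) S0.
Proof.
rewrite prob_T_le_natE addrC -iter_KopN -iter_Kop_addc; congr (iter t _ _ S0).
by apply/funext => B; case: (_ <= _); rewrite /= ?oppr0 ?add0r // addNr.
Qed.

Lemma prob_T_le_nat_ge0 (R : realType) (q : R) (P : protocol) (n : nat) (G : rel 'I_n)
    (S0 : {set 'I_n}) (t : nat) : 0 <= q <= 1 -> 0 <= prob_T_le_nat q P G S0 t.
Proof.
move=> q01; rewrite prob_T_le_nat_compl subr_ge0.
by apply: iter_Kop_le1 => // B; case: (threshold R n <= _).
Qed.

Lemma prob_T_le_nat_le1 (R : realType) (q : R) (P : protocol) (n : nat) (G : rel 'I_n)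
    (S0 : {set 'I_n}) (t : nat) : 0 <= q <= 1 -> prob_T_le_nat q P G S0 t <= 1.
Proof.
by move=> q01; rewrite prob_T_le_natE; apply: iter_Kop_le1 => // B; case: (threshold R n <= _).
Qed.

Lemma prob_T_le_int_01 (R : realType) (q : R) (P : protocol) (n : nat) (G : rel 'I_n)
    (S0 : {set 'I_n}) (k : int) : 0 <= q <= 1 -> 0 <= prob_T_le_int q P G S0 k <= 1.
Proof.
move=> q01; rewrite /prob_T_le_int; case: ifP => _; first by rewrite lexx ler01.
by rewrite prob_T_le_nat_ge0 ?prob_T_le_nat_le1.
Qed.

Lemma card_start_set (n m : nat) : (m < n)%N -> #|start_set n m| = 1%N.
Proof.
move=> mn; rewrite (_ : start_set n m = [set Ordinal mn]%SET) ?cards1 //.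
by apply/setP => v; rewrite !inE.
Qed.

Lemma iter_push_card_le (R : realType) (q c : R) (n : nat) (G : rel 'I_n) (t : nat)
    (A : {set 'I_n}) : 0 < q <= 1 -> 0 <= c ->
  iter t (Kop q G Push) (fun B => c * #|B|%:R) A <= c * ((1 + q) ^+ t * #|A|%:R).
Proof.
move=> q01 c0; have q01' : 0 <= q <= 1 by case/andP: q01 => /ltW -> ->.
have qq : 0 <= 1 + q by case/andP: q01' => q0 _; rewrite addr_ge0.
elim: t A => [|t IH] A; first by rewrite expr0 mul1r.
rewrite iterS.
apply: le_trans (_ : Kop q G Push (fun B => c * (1 + q) ^+ t * #|B|%:R) A <= _).
  by apply: Kop_le => // B _; rewrite -mulrA.
rewrite KopZ exprSr -!mulrA ler_wpM2l // ler_wpM2l ?exprn_ge0 //.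
exact: Kop_push_card_le.
Qed.

(** Of the slack 4 eta, each of the three phases with factor [rho] gets eta log n rounds and the
    middle phase the remaining (L + eta) log n. Each of the four errors is then at most a constant
    times log n times a negative power of n. *)
Lemma whp_upper (R : realType) (eps q : R) (G Gt : forall n : nat, rel 'I_n) (s : nat -> nat)
    (P : protocol) (eta e : R) :
  0 < eps < 1 / 2 -> 0 < q <= 1 -> expander_seq R G ->
  (forall n, keeps_fraction eps (G n) (Gt n)) ->
  (forall n, (0 < n)%N -> (s n < n)%N) -> 0 < eta -> 0 < e ->
  \forall n \near \oo, 1 - e <= prob_T_le q P (Gt n) (start_set n (s n))
    (((ln (1 + (growth_factor P)%:R * q))^-1 + 4 * eta) * ln (n%:R : R)).
Proof.
move=> eps01 q01 expG keepG start eta0 e0; case/andP: eps01 => ep0 ep2; case/andP: (q01) => q0 q1.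
have [symG _ _ _] := expG.
set b := 1 + (growth_factor P)%:R * q; set L := (ln b)^-1.
have b1 : 1 < b by rewrite ltrDl mulr_gt0 // ltr0n; case: (P).
have lb0 : 0 < ln b by rewrite ln_gt0.
have L0 : 0 < L by rewrite invr_gt0.
(* Half of the middle phase's eta buys the room d = rho1 - 1/b for the error terms; the other half
   makes the exponent [c1] below positive. *)
pose a := (L + eta / 2)^-1; pose rho1 := expR (- a).
have a0 : 0 < a by rewrite invr_gt0 addr_gt0 // divr_gt0.
have ab : a < ln b.
  by rewrite -[ltRHS]invrK ltf_pV2 ?posrE // ?addr_gt0 ?divr_gt0 // ltrDl divr_gt0.
pose d := rho1 - b^-1.
have d0 : 0 < d.
  rewrite subr_gt0 -[b]lnK ?posrE ?(lt_trans ltr01) // -expRN ltr_expR ltrN2.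
  exact: ab.
have dE : rho1 = b^-1 + d by rewrite /d addrC subrK.
have rr : 0 < rho1 <= 1 by rewrite expR_gt0 -[leRHS]expR0 ler_expR oppr_le0 ltW.
have rho1E : rho1 = expR (- a) by [].
have aE : a = (L + eta / 2)^-1 by [].
have bE : b = 1 + (growth_factor P)%:R * q by [].
clearbody d rho1 a L b.
(* The slack d is shared out as 272 (g + k) <= d / 2 and 32 / K <= d / 4,
   the error terms of Kop_inv_potential on K <= |A| < g n. *)
pose g := Num.min (1 / 4) (d / 1088).
pose k := Num.min (Num.min (1 / 4) (eps / 4)) (d / 1088).
pose K := 1 + 128 / d.
have g0 : 0 < g by rewrite lt_min; apply/andP; split; [lra|rewrite divr_gt0 ?ltr0n].
have g2 : g <= 1 / 4 by rewrite ge_min lexx.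
have gd : g <= d / 1088 by rewrite ge_min lexx orbT.
have k0 : 0 < k.
  by rewrite !lt_min -andbA; apply/and3P; split; [lra|lra|rewrite divr_gt0 ?ltr0n].
have k2 : k <= 1 / 4 by rewrite !ge_min lexx.
have ke : k <= eps / 4 by rewrite !ge_min lexx orbT.
have kd : k <= d / 1088 by rewrite !ge_min lexx !orbT.
have K1 : 1 <= K by rewrite lerDl divr_ge0 // ltW.
have Kd : 32 / K <= d / 4.
  have Kp : 0 < K by rewrite (lt_le_trans ltr01).
  rewrite ler_pdivrMr //.
  have -> : d / 4 * K = d / 4 + 32 by rewrite /K; field; rewrite gt_eqF.
  by rewrite lerDr divr_ge0 // ltW.
have hrho1 : b^-1 + 272 * (g + k) + 32 / K <= rho1.
  by rewrite dE; lra.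
clearbody g k K; clear gd kd Kd.
have k2' : k <= 1 / 2 by rewrite (le_trans k2) //; lra.
have gg : 0 < g <= 1 / 2 by rewrite g0 (le_trans g2) //; lra.
pose rho := 1 - q * eps / 20.
have qe0 : 0 < q * eps by rewrite mulr_gt0.
have qe1 : q * eps <= 1 / 2 by rewrite (le_trans _ (ltW ep2)) // ler_piMl // ltW.
have rho0 : 0 < rho by rewrite /rho; lra.
have rho1' : rho < 1 by rewrite /rho; lra.
have lrho : ln rho < 0 by rewrite ln_lt0 // rho0.
have rhoi : 0 <= rho^-1 by rewrite invr_ge0 ltW.
pose c0 := - (eta * ln rho).
have c0_gt0 : 0 < c0 by rewrite /c0 -mulrN mulr_gt0 // oppr_gt0.
pose c1 := (L + eta) * a - 1.
have c1_gt0 : 0 < c1.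
  rewrite subr_gt0 aE ltr_pdivlMr ?mul1r ?addr_gt0 ?divr_gt0 //; lra.
have C1 : 0 <= K * rho^-1 by rewrite mulr_ge0 // (le_trans _ K1).
have C2 : 0 <= 2 * g / K * rho1^-1.
  by case/andP: rr => /ltW r0 _; rewrite !mulr_ge0 ?invr_ge0 ?r0 ?(ltW g0) // (le_trans _ K1).
have C3 : 0 <= (2 * g)^-1 * rho^-1 by rewrite mulr_ge0 // invr_ge0 mulr_ge0 // ltW.
have e4 : 0 < e / 4 by rewrite divr_gt0.
near=> n.
have prn : pseudorandom (G n) ((maxdeg (G n))%:R : R) k.
  by near: n; exact: expander_pseudorandom.
have symn : symmetric (G n) by case: (symG n).
have n1 : (0 < n)%N by near: n; exists 1%N.
have Kn : 2 * K <= n%:R by near: n; exact: nbhs_infty_ger.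
have ge1 : 1 <= K <= n%:R / 2 by rewrite K1 ler_pdivlMr // mulrC.
have l2 : 2 <= ln (n%:R : R) by near: n; exact: ln_ge_near.
(* This gives (L + eta) l >= 1, which absorbs the rounding of T, so that three phases of [tau]
   rounds fit into T. *)
have lL : (L + eta)^-1 <= ln (n%:R : R) by near: n; exact: ln_ge_near.
have D1 : K * rho^-1 * (ln n%:R * expR (- (c0 * ln (n%:R : R)))) <= e / 4.
  by near: n; exact: ln_expR_decay.
have D2 : 2 * g / K * rho1^-1 * (ln n%:R * expR (- (c1 * ln (n%:R : R)))) <= e / 4.
  by near: n; exact: ln_expR_decay.
have D3 : (2 * g)^-1 * rho^-1 * (ln n%:R * expR (- (c0 * ln (n%:R : R)))) <= e / 4.
  by near: n; exact: ln_expR_decay.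
have D4 : rho^-1 * (ln n%:R * expR (- (c0 * ln (n%:R : R)))) <= e / 4.
  by near: n; exact: ln_expR_decay.
have nE : n%:R = expR (ln (n%:R : R)) by rewrite lnK // posrE ltr0n.
set S0 := start_set n (s n).
have S1 : 1 <= #|S0|%:R :> R by rewrite card_start_set ?start.
have kf := keepG n.
have NG := @not_goal_bound R q eps k (maxdeg (G n))%:R n (G n) (Gt n) q01 ep0 k0.
set l := ln (n%:R : R) in l2 lL D1 D2 D3 D4 nE *.
have l0 : 0 < l by rewrite (lt_le_trans _ l2).
set x := (L + 4 * eta) * l.
have x0 : 0 <= x by rewrite mulr_ge0 ?addr_ge0 ?mulr_ge0 ?(ltW L0) ?(ltW eta0) ?(ltW l0).
have el0 : 0 <= eta * l by rewrite mulr_ge0 // ltW.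
pose T := Num.truncn x; pose tau := Num.truncn (eta * l).
have /andP[_ hT] := truncn_itv x0.
have /andP[htau1 htau2] := truncn_itv el0.
have prE : prob_T_le q P (Gt n) S0 x = prob_T_le_nat q P (Gt n) S0 T.
  rewrite /prob_T_le /prob_T_le_int floor_lt0 ltNge x0 /=.
  by rewrite /T truncn_floor x0.
rewrite -/T -natr1 in hT; rewrite -/tau in htau1; rewrite -/tau -natr1 in htau2.
have lL' : 1 <= (L + eta) * l.
  by rewrite -ler_pdivrMl ?mulr1 // addr_gt0.
have xE : x = (L + eta) * l + 3 * (eta * l) by rewrite /x; ring.
have tT : (tau + (tau + tau) <= T)%N.
  by rewrite -(ler_nat R) !natrD; move: hT htau1 lL'; rewrite xE; lra.
pose t1 := (T - (tau + (tau + tau)))%N.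
have TE : T = (tau + (t1 + (tau + tau)))%N by rewrite addnCA subnK.
have ht1 : (L + eta) * l - 1 <= t1%:R.
  by rewrite /t1 natrB // !natrD; move: hT htau1; rewrite xE; lra.
have {}NG := NG _ _ (ltW ep2) prn kf symn P K g rho1 tau t1 tau tau S0.
rewrite prE prob_T_le_nat_compl lerD2l lerN2 TE.
clear TE; clearbody t1 tau.
have rge : 0 <= rho1 by case/andP: rr => /ltW.
rewrite bE in hrho1.
apply: le_trans (NG k2' ke ge1 gg rge hrho1 l2 S1) _.
have tau_bd : rho ^+ tau <= rho^-1 * expR (- (c0 * l)).
  have -> : - (c0 * l) = (eta * l) * ln rho by rewrite /c0; ring.
  by apply: exprn_le_expR; [rewrite rho0 ltW|rewrite lerBlDr ltW].
have grow y : 0 <= y -> y <= l * y.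
  by move=> y0; rewrite ler_peMl // (le_trans _ l2) // ler1n.
have ex c : 0 <= expR (- (c * l)) by exact: expR_ge0.
have B1 : K * rho ^+ tau <= e / 4.
  apply: le_trans D1; rewrite -mulrA ler_wpM2l ?(le_trans _ K1) //.
  by apply: le_trans tau_bd _; rewrite ler_wpM2l // grow.
have B3 : (2 * g)^-1 * rho ^+ tau <= e / 4.
  apply: le_trans D3; rewrite -mulrA ler_wpM2l ?invr_ge0 ?mulr_ge0 ?(ltW g0) //.
  by apply: le_trans tau_bd _; rewrite ler_wpM2l // grow.
have B4 : l * rho ^+ tau <= e / 4.
  apply: le_trans D4; rewrite mulrCA ler_wpM2l ?(ltW l0) //.
have B2 : 2 * g * n%:R / K * rho1 ^+ t1 <= e / 4.
  apply: le_trans D2.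
  have := exprn_le_expR rr ht1; rewrite {3}rho1E expRK => h.
  have -> : 2 * g * n%:R / K * rho1 ^+ t1 = 2 * g / K * (n%:R * rho1 ^+ t1) by ring.
  have gK : 0 <= 2 * g / K.
    by rewrite !mulr_ge0 ?invr_ge0 ?(ltW g0) // (le_trans _ K1).
  rewrite -[leRHS]mulrA ler_wpM2l //.
  apply: le_trans (_ : n%:R * (rho1^-1 * expR ((L + eta) * l * - a)) <= _).
    by rewrite ler_wpM2l.
  rewrite mulrCA ler_wpM2l ?invr_ge0 // nE -expRD.
  have -> : l + (L + eta) * l * - a = - (c1 * l) by rewrite /c1; ring.
  exact: grow.
apply: le_trans (lerD B1 (lerD B2 (lerD B3 B4))) _.
by rewrite le_eqVlt; apply/orP; left; apply/eqP; field.
Unshelve. all: by end_near.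
Qed.


(** Markov's inequality for |I_t|: the threshold is at least n/2, while the mean (1+q)^t is at most
    n to the power 1 - eta ln(1+q). *)
Lemma whp_push_lower (R : realType) (q : R) (Gt : forall n : nat, rel 'I_n) (s : nat -> nat)
    (eta e : R) :
  0 < q <= 1 -> (forall n, (0 < n)%N -> (s n < n)%N) -> 0 < eta -> 0 < e ->
  \forall n \near \oo, prob_T_lt q Push (Gt n) (start_set n (s n))
    (((ln (1 + q))^-1 - eta) * ln (n%:R : R)) <= e.
Proof.
move=> q01 start eta0 e0; have q01' : 0 <= q <= 1 by case/andP: q01 => /ltW -> ->.
case/andP: (q01) => q0 q1.
have lb0 : 0 < ln (1 + q) by rewrite ln_gt0 // ltrDl.
have c0 : 0 < eta * ln (1 + q) by rewrite mulr_gt0.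
near=> n.
have n1 : (0 < n)%N by near: n; exists 1%N.
have l2 : 2 <= ln (n%:R : R) by near: n; exact: ln_ge_near.
have D1 : 2 * (ln n%:R * expR (- (eta * ln (1 + q) * ln (n%:R : R)))) <= e.
  by near: n; exact: ln_expR_decay.
have n0 : 0 < n%:R :> R by rewrite ltr0n.
set l := ln (n%:R : R) in l2 D1 *.
have l0 : 0 < l by rewrite (lt_le_trans _ l2).
have nE : n%:R = expR l by rewrite lnK.
rewrite /prob_T_lt /prob_T_le_int; set y := _ * l; case: ifPn => [_|]; first exact: ltW.
rewrite -leNgt => hk; set t := `|_|%N.
have ty : t%:R <= y.
  have -> : t%:R = (Num.ceil y - 1)%:~R :> R by rewrite -[in RHS](gez0_abs hk) -/t.
  exact: ltW (ceilB1_lt y).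
have th0 : n%:R / 2 <= threshold R n.
  rewrite /threshold -/l; have : n%:R / l <= n%:R / 2.
    by rewrite ler_wpM2l ?(ltW n0) // lef_pV2 ?posrE.
  lra.
have th1 : 0 < threshold R n by apply: lt_le_trans th0; rewrite divr_gt0.
rewrite prob_T_le_natE.
apply: le_trans (_ : iter t (Kop q (Gt n) Push) (fun B => (threshold R n)^-1 * #|B|%:R)
   (start_set n (s n)) <= _).
  apply: iter_Kop_le => // B; case: (boolP (threshold R n <= _)) => h.
    by rewrite mulrC ler_pdivlMr // mul1r.
  by rewrite mulr_ge0 ?invr_ge0 ?ler0n // ltW.
apply: le_trans (iter_push_card_le _ _ _ q01 _) _; first by rewrite invr_ge0 ltW.
rewrite card_start_set ?start // mulr1; apply: le_trans D1.
apply: le_trans (_ : (n%:R / 2)^-1 * expR (y * ln (1 + q)) <= _).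
  apply: ler_pM; rewrite ?invr_ge0 ?(ltW th1) ?exprn_ge0 ?addr_ge0 ?(ltW q0) //.
    by rewrite lef_pV2 ?posrE ?divr_gt0.
  rewrite -[X in X ^+ t]lnK ?posrE ?ltr_pwDl ?(ltW q0) // -expRM_natl ler_expR.
  by rewrite ler_wpM2r // ltW.
have -> : y * ln (1 + q) = l - eta * ln (1 + q) * l.
  by rewrite /y; field; rewrite gt_eqF.
(* The spare factor l >= 1 only matches the form of [ln_expR_decay]. *)
rewrite invf_div -[leLHS]mulrA ler_wpM2l // expRD -nE mulKf ?gt_eqF //.
by rewrite ler_peMl ?expR_ge0 //; lra.
Unshelve. all: by end_near.
Qed.

(** The passage from windows eta log n with eta fixed to a single window of size o(log n). *)
Lemma ln_window (R : realType) (F : nat -> R -> R) :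
  (forall eta e : R, 0 < eta -> 0 < e ->
     \forall n \near \oo, `|1 - F n (eta * ln n%:R)| <= e) ->
  exists g : nat -> R,
    [/\ forall n, 0 < g n, (fun n => g n / ln (n%:R : R)) @ \oo --> (0 : R) &
        (fun n => F n (g n)) @ \oo --> (1 : R)].
Proof.
move=> H; have [x [x0 xl xF]] := diagonal_sequence (F := fun n eta => F n (eta * ln n%:R)) H.
have l0 : \forall n \near \oo, 0 < ln (n%:R : R).
  by near=> n; apply: lt_le_trans ltr01 _; near: n; exact: ln_ge_near.
(* The window must be positive for every n, and ln n vanishes for n <= 1; there 1 is used. *)
exists (fun n => if 0 < ln (n%:R : R) then x n * ln n%:R else 1); split.
- by move=> n; case: ifP => // h; rewrite mulr_gt0.
- apply: cvg_trans xl; apply: near_eq_cvg; near=> n.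
  have h : 0 < ln (n%:R : R) by near: n.
  by rewrite h mulfK // gt_eqF.
- apply: cvg_trans xF; apply: near_eq_cvg; near=> n.
  have h : 0 < ln (n%:R : R) by near: n.
  by rewrite h.
Unshelve. all: by end_near.
Qed.

(** * Assembly of both claims *)

Theorem theorem1p7 (R : realType) (eps q : R) (G Gt : forall n : nat, rel 'I_n)
    (s : nat -> nat) :
  0 < eps < 1 / 2 ->
  0 < q <= 1 ->
  expander_seq R G ->
  (forall n, keeps_fraction eps (G n) (Gt n)) ->
  (forall n, (0 < n)%N -> (s n < n)%N) ->
  (* (a) whp  T_push(Gt_n) = log_{1+q} n + o(log n) *)
  (exists g : nat -> R,
     (forall n, 0 < g n) /\
     (fun n : nat => g n / ln (n%:R : R)) @ \oo --> (0 : R) /\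
     (fun n : nat =>
        prob_T_between q Push (Gt n) (start_set n (s n))
          (logb (1 + q) n%:R - g n) (logb (1 + q) n%:R + g n)) @ \oo --> (1 : R))
  /\
  (* (b) if moreover delta(G_n) >= alpha n, whp T_pp(Gt_n) <= log_{1+2q} n + o(log n) *)
  ((exists alpha : R, 0 < alpha <= 1 /\
       \forall n \near \oo, alpha * n%:R <= (mindeg (G n))%:R) ->
   exists g : nat -> R,
     (forall n, 0 < g n) /\
     (fun n : nat => g n / ln (n%:R : R)) @ \oo --> (0 : R) /\
     (fun n : nat =>
        prob_T_le q PushPull (Gt n) (start_set n (s n))
          (logb (1 + 2 * q) n%:R + g n)) @ \oo --> (1 : R)).
Proof.
move=> eps01 q01 expG keepG start.
have q01' : 0 <= q <= 1 by case/andP: q01 => /ltW -> ->.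
split; last first.
  move=> _.
  pose F n y := prob_T_le q PushPull (Gt n) (start_set n (s n)) (logb (1 + 2 * q) n%:R + y).
  have [|g [g0 gl gF]] := @ln_window R F; last by exists g.
  (* [whp_upper] spends four times its slack, hence eta/4. *)
  move=> eta e eta0 e0; have eta4 : 0 < eta / 4 by rewrite divr_gt0.
  near=> n.
  have h : 1 - e <= F n (eta * ln n%:R).
    rewrite /F /logb.
    have -> : ln n%:R / ln (1 + 2 * q) + eta * ln n%:R =
      ((ln (1 + 2 * q))^-1 + 4 * (eta / 4)) * ln n%:R.
      by move: (ln (1 + 2 * q))^-1 => i; field.
    near: n; exact: (whp_upper PushPull eps01 q01 expG keepG start eta4 e0).
  have /andP[_ h1] : 0 <= F n (eta * ln n%:R) <= 1 by exact: prob_T_le_int_01.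
  by rewrite ger0_norm ?subr_ge0 //; lra.
pose F n y := prob_T_between q Push (Gt n) (start_set n (s n))
  (logb (1 + q) n%:R - y) (logb (1 + q) n%:R + y).
have [|g [g0 gl gF]] := @ln_window R F; last by exists g.
move=> eta e eta0 e0; have eta4 : 0 < eta / 4 by rewrite divr_gt0.
have e2 : 0 < e / 2 by rewrite divr_gt0.
near=> n; rewrite /F /prob_T_between.
set a := prob_T_le _ _ _ _ _; set b := prob_T_lt _ _ _ _ _.
have ha : 1 - e / 2 <= a.
  rewrite /a /logb.
  (* The factor 1 * q is [growth_factor] at [Push], kept so that [whp_upper] matches. *)
  have -> : ln n%:R / ln (1 + q) + eta * ln n%:R =
    ((ln (1 + 1 * q))^-1 + 4 * (eta / 4)) * ln n%:R.
    by rewrite mul1r; move: (ln (1 + q))^-1 => i; field.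
  near: n; exact: (whp_upper Push eps01 q01 expG keepG start eta4 e2).
have hb : b <= e / 2.
  rewrite /b /logb.
  have -> : ln n%:R / ln (1 + q) - eta * ln n%:R =
    ((ln (1 + q))^-1 - eta) * ln n%:R by ring.
  near: n; exact: (whp_push_lower Gt q01 start eta0 e2).
have /andP[_ a1] : 0 <= a <= 1 by exact: prob_T_le_int_01.
have /andP[b0 _] : 0 <= b <= 1 by exact: prob_T_le_int_01.
by rewrite ger0_norm; lra.
Unshelve. all: by end_near.
Qed.
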